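(* Let $n\geq 2$ be an integer, let $a>0$ and let $0<s<\frac{n}{2}$. Then there is a constant $C(n,s,a)>0$, depending only on $n$, $s$ and $a$, such that for every real skew-symmetric $n\times n$ matrix $\theta$ and every strictly positive element $x\in C^\infty(\mathbb{T}_\theta^n)$ of the noncommutative torus $\mathbb{T}_\theta^n$, $$ \tau\left[ x^2 \log\left( \frac{x^2}{\|x\|_{L_2}^2} \right) \right] \leq C(n,s,a)\, \|x\|_{W_2^s}^2 - \frac{n}{s}\,(\log a+1)\, \|x\|_{L_2}^2 . $$
   Context: Noncommutative torus. Let $\theta=(\theta_{jk})$ be a real skew-symmetric $n\times n$ matrix, and let $\mathbb{T}^n=\mathbb{R}^n/(2\pi\mathbb{Z})^n$. Equip $L_2(\mathbb{T}^n)$ with the inner product $\langle f|g\rangle=(2\pi)^{-n}\int_{\mathbb{T}^n} f(t)\overline{g(t)}\,dt$. The $C^*$-algebra $C(\mathbb{T}_\theta^n)$ is generated by unitaries $U_1,\ldots,U_n$ satisfying $$U_kU_j=e^{2\pi i\theta_{jk}}U_jU_k,\qquad 1\leq j,k\leq n.$$ These are realized concretely as unitary operators on $L_2(\mathbb{T}^n)$, for instance by $(U_jf)(t)=e^{it_j}f(t+\pi\theta_j)$, where $\theta_j$ is the $j$-th column of $\theta$. Thus $C(\mathbb{T}_\theta^n)$ is a $C^*$-subalgebra of the algebra $\mathscr{L}(L_2(\mathbb{T}^n))$ of bounded operators on $L_2(\mathbb{T}^n)$. For $k=(k_1,\ldots,k_n)\in\mathbb{Z}^n$ write $U^k=U_1^{k_1}\cdots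 U_n^{k_n}$. Trace and $L_2$. Set $\tau(T)=\langle T1|1\rangle_{L_2(\mathbb{T}^n)}$ for $T\in\mathscr{L}(L_2(\mathbb{T}^n))$. This restricts to a tracial state on $C(\mathbb{T}_\theta^n)$ with $\tau(1)=1$ and $\tau(U^k)=0$ for $k\neq 0$. The Hilbert space $L_2(\mathbb{T}_\theta^n)$ is the completion of $C(\mathbb{T}_\theta^n)$ for the inner product $\langle x|y\rangle_{L_2(\mathbb{T}_\theta^n)}=\tau(xy^* )$, and $\|\cdot\|_{L_2}$ denotes its norm. The family $\{U^k\}_{k\in\mathbb{Z}^n}$ is an orthonormal basis of it, so every $x\in L_2(\mathbb{T}_\theta^n)$ is written uniquely as $x=\sum_{k\in\mathbb{Z}^n}x_kU^k$ with $x_k=\langle x|U^k\rangle_{L_2(\mathbb{T}_\theta^n)}$. Smooth elements. $C^\infty(\mathbb{T}_\theta^n)$ is the dense $*$-subalgebra of those $x\in C(\mathbb{T}_\theta^n)$ of the form $x=\sum_{k\in\mathbb{Z}^n} x_kU^k$ with $(x_k)_{k\in\mathbb{Z}^n}$ a rapidly decaying sequence of complex numbers. Equivalently, it consists of the smooth vectors of the action of $\mathbb{R}^n$ on $C(\mathbb{T}_\theta^n)$ determined by $\alpha_r(U^k)=e^{ir\cdot k}U^k$, $r\in\mathbb{R}^n$. Sobolev norm. For $s\geq 0$, $\|x\|_{W_2^s}^2=\sum_{k\in\mathbb{Z}^n}(1+|k|^2)^s|x_k|^2$, where $|k|$ is the Euclidean norm of $k$. Strict positivity. An element $x$ is strictly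 positive (written $x>0$) if it is selfadjoint and its spectrum is contained in $(0,\infty)$. The logarithm $\log(x^2/\|x\|_{L_2}^2)$ is then defined by functional calculus. *)

(* Defs.v *)
From HB Require Import structures.
From mathcomp Require Import all_boot all_order all_algebra.
From mathcomp Require Import finmap generic_quotient ring_quotient.
From mathcomp Require Import all_classical all_reals all_analysis.
From mathcomp Require Import complex.

Set Implicit Arguments.
Unset Strict Implicit.
Unset Printing Implicit Defensive.
Import Order.TTheory GRing.Theory Num.Theory.
Import numFieldNormedType.Exports.

Local Open Scope classical_set_scope.
Local Open Scope ring_scope.
Local Open Scope complex_scope.

Section torus_measure.
Variable R : realType.

Definition Rn (n : nat) : Type := n.-tuple (measurableTypeR R).
HB.instance Definition _ n := Measurable.on (Rn n).

Lemma two_pi_gt0 : 0 < 2 * pi :> R.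
Proof. by rewrite mulr_gt0 ?pi_gt0. Qed.

Definition circle_measure : probability (measurableTypeR R) R :=
  uniform_prob two_pi_gt0.

Definition cons_tuple n (p : measurableTypeR R * Rn n) : Rn n.+1 :=
  [tuple of p.1 :: p.2].

Lemma measurable_cons_tuple n : measurable_fun setT (@cons_tuple n).
Proof. exact: measurable_cons. Qed.

HB.instance Definition _ n :=
  isMeasurableFun.Build _ _ _ _ (@cons_tuple n) (@measurable_cons_tuple n).

(* (2 pi)^-n dt on the fundamental domain [0, 2 pi]^n, as an iterated product *)
Fixpoint torus_measure n : probability (Rn n) R :=
  match n with
  | 0 => dirac ([tuple] : Rn 0)
  | m.+1 => distribution (circle_measure \x torus_measure m)%E (@cons_tuple m)
  end.

End torus_measure.

Section L2_torus.
Variables (R : realType) (n : nat).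
Local Notation C := R[i].
Local Notation mu := (torus_measure R n).
Local Notation Re := (@complex.Re R).
Local Notation Im := (@complex.Im R).

Definition translate (c : 'I_n -> R) (t : Rn R n) : Rn R n :=
  [tuple (tnth t l + c l : measurableTypeR R) | l < n].

Definition periodic (f : Rn R n -> C) : Prop :=
  forall (m : 'I_n -> int) t,
    f (translate (fun l => 2 * pi * (m l)%:~R) t) = f t.

(* functions on R^n / (2 pi Z)^n whose modulus is square-integrable, i.e.
   whose real and imaginary parts are *)
Definition sq_integrable : {pred (Rn R n -> C)} :=
  [pred f : Rn R n -> C | [&& `[< periodic f >],
     (Re \o f) \in Lfun mu 2%:E & (Im \o f) \in Lfun mu 2%:E]].

Lemma sq_integrable_submod_closed : submod_closed sq_integrable.
Proof.
have [L0 LD] := Lfun_submod_closed mu (lee1n 2 : (1 <= 2%:E :> \bar R)%E).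
split.
  apply/and3P; split; first by apply/asboolP.
    by rewrite (_ : _ \o _ = 0).
  by rewrite (_ : _ \o _ = 0).
move=> a f g /and3P[/asboolP pf f1 f2] /and3P[/asboolP pg g1 g2].
have L1 h : h \in Lfun mu 2%:E -> forall b : R, b *: h \in Lfun mu 2%:E.
  by move=> hL b; rewrite -[_ *: _]addr0; exact: LD.
apply/and3P; split.
- apply/asboolP => m t; rewrite -[LHS]/(a * f _ + g _) pf pg; exact: erefl.
- rewrite (_ : _ \o _ = Re a *: (Re \o f) +
    ((- Im a) *: (Im \o f) + (Re \o g))); last first.
    apply/funext => t; rewrite -[LHS]/(Re (a * f t + g t)).
    rewrite -[RHS]/(Re a * Re (f t) + (- Im a * Im (f t) + Re (g t))).
    by case: (f t) (g t) a => [x y] [z w] [b c]; rewrite addrA mulNr.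
  by apply: (LD) => //; exact: LD.
- rewrite (_ : _ \o _ = Re a *: (Im \o f) +
    (Im a *: (Re \o f) + (Im \o g))); last first.
    apply/funext => t; rewrite -[LHS]/(Im (a * f t + g t)).
    rewrite -[RHS]/(Re a * Im (f t) + (Im a * Re (f t) + Im (g t))).
    by case: (f t) (g t) a => [x y] [z w] [b c]; rewrite addrA.
  by apply: (LD) => //; exact: LD.
Qed.

HB.instance Definition _ := GRing.isSubmodClosed.Build _ _ sq_integrable
  sq_integrable_submod_closed.

Record L2fun := MkL2fun { L2val :> Rn R n -> C ; _ : L2val \in sq_integrable }.
HB.instance Definition _ := [isSub for L2val].
HB.instance Definition _ := [Choice of L2fun by <:].
HB.instance Definition _ := [SubChoice_isSubLmodule of L2fun by <:].

Definition L2null : {pred L2fun} :=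
  [pred f : L2fun | `[< {ae mu, forall t, f t = 0} >]].

Lemma L2null_submod_closed : submod_closed L2null.
Proof.
split; first by apply/asboolP; exact: aeW.
move=> a f g /asboolP f0 /asboolP g0; apply/asboolP.
apply: filterS2 f0 g0 => t f0 g0.
by rewrite /= -[LHS]/(a * f t + g t) f0 g0 mulr0 addr0.
Qed.

HB.instance Definition _ := GRing.isSubmodClosed.Build _ _ L2null
  L2null_submod_closed.

Definition L2 : Type := Quotient.quot L2null.
HB.instance Definition _ := GRing.Zmodule.on L2.
HB.instance Definition _ := Quotient.on L2.

Lemma pi_L2D (f g : L2fun) :
  \pi_L2%qT (f + g) = \pi_L2%qT f + \pi_L2%qT g.
Proof. exact: (@Quotient.pi_add _ L2null). Qed.

Definition L2_scale (a : C) (x : L2) : L2 := \pi_L2%qT (a *: repr x).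

Lemma pi_L2_scale a (f : L2fun) : L2_scale a (\pi_L2%qT f) = \pi_L2%qT (a *: f).
Proof.
apply/eqP; rewrite /L2_scale -(@Quotient.idealrBE _ L2null) -scalerBr.
by rewrite rpredZ// Quotient.idealrBE reprK.
Qed.

Lemma L2_scaleA a b x : L2_scale a (L2_scale b x) = L2_scale (a * b) x.
Proof.
by elim/quotW: x => f; rewrite [L2_scale b _]pi_L2_scale !pi_L2_scale scalerA.
Qed.

Lemma L2_scale1 : left_id 1 L2_scale.
Proof. by elim/quotW => f; rewrite pi_L2_scale scale1r. Qed.

Lemma L2_scaleDr : right_distributive L2_scale +%R.
Proof.
move=> a; elim/quotW => f; elim/quotW => g.
by rewrite !pi_L2_scale -!pi_L2D pi_L2_scale scalerDr.
Qed.

Lemma L2_scaleDl x : {morph L2_scale^~ x : a b / a + b}.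
Proof.
by elim/quotW: x => f a b; rewrite !pi_L2_scale scalerDl pi_L2D.
Qed.

HB.instance Definition _ := GRing.Zmodule_isLmodule.Build C L2
  L2_scaleA L2_scale1 L2_scaleDr L2_scaleDl.

Definition complex_integral (f : Rn R n -> C) : C :=
  (\int[mu]_t Re (f t)) +i* (\int[mu]_t Im (f t)).

Definition inner (x y : L2) : C :=
  complex_integral (fun t => repr x t * (repr y t)^*%C).

Definition L2norm (x : L2) : R := Num.sqrt (Re (inner x x)).

Lemma sq_integrable_cst (c : C) : cst c \in sq_integrable.
Proof.
by apply/and3P; split; [exact/asboolP|exact: Lfun_cst|exact: Lfun_cst].
Qed.

Definition L2one : L2 := \pi_L2%qT (MkL2fun (sq_integrable_cst 1)).

End L2_torus.

Section operators.
Variables (R : realType) (n : nat).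
Local Notation C := R[i].
Local Notation H := (L2 R n).
Local Notation Re := (@complex.Re R).
Implicit Types S T : H -> H.

Local Open Scope ereal_scope.

Definition opnorm T : \bar R :=
  ereal_sup [set (L2norm (T f))%:E | f in [set f | (L2norm f <= 1)%R]].

Definition bounded_op : set (H -> H) :=
  [set T | linear T /\ opnorm T < +oo].

Definition op_cvg (u : nat -> H -> H) T : Prop :=
  (fun m => opnorm (u m \- T)%R) @ \oo --> 0.

Local Close Scope ereal_scope.

(* T^*, which exists and is unique for every bounded T *)
Definition adjoint T : H -> H :=
  xget 0 [set S | bounded_op S /\ forall f g, inner (T f) g = inner f (S g)].

Definition selfadjoint T : Prop := forall f g, inner (T f) g = inner f (T g).

Definition invertible T : Prop :=
  exists S, [/\ bounded_op S, S \o T = id & T \o S = id].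

Definition spectrum T : set C := [set l | ~ invertible (l \*: id \- T)].

(* [0 < l] in the partial order of R[i] means that l is real and positive *)
Definition strictly_positive T : Prop :=
  selfadjoint T /\ forall l, spectrum T l -> 0 < l.

Definition poly_op (p : {poly R}) T : H -> H :=
  fun f => \sum_(i < size p) (p`_i)%:C *: iter i T f.

(* S is g(T) for a selfadjoint T and a function g continuous on its spectrum:
   S is the norm limit of p_m(T) with p_m polynomials converging to g uniformly
   on the spectrum of T *)
Definition is_functional_calculus (g : R -> R) T S : Prop :=
  bounded_op S /\
  exists2 p : nat -> {poly R},
    (forall e : R, 0 < e -> \forall m \near \oo,
      forall l : R, spectrum T l%:C -> `|(p m).[l] - g l| <= e) &
    op_cvg (fun m => poly_op (p m) T) S.

Definition functional_calculus (g : R -> R) T : H -> H :=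
  xget 0 (is_functional_calculus g T).

Definition cstar_subalgebra (A : set (H -> H)) : Prop :=
  [/\ A `<=` bounded_op /\ A id,
      forall a S T, A S -> A T -> A (a \*: S \+ T),
      forall S T, A S -> A T -> A (S \o T),
      forall T, A T -> A (adjoint T) &
      forall T, bounded_op T ->
        (forall e : R, 0 < e ->
           exists2 S, A S & (opnorm (T \- S)%R < e%:E)%E) -> A T].

Definition tau T : C := inner (T (L2one R n)) (L2one R n).

Definition tau_norm T : R := Num.sqrt (Re (tau (T \o adjoint T))).

End operators.

Section noncommutative_torus.
Variables (R : realType) (n : nat) (theta : 'M[R]_n).
Local Notation C := R[i].
Local Notation H := (L2 R n).
Local Notation Re := (@complex.Re R).
Implicit Types (x : H -> H) (k : 'rV[int]_n).

(* (U_j f)(t) = e^(i t_j) f(t + pi theta_j), with theta_j the j-th column of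
   theta; by translation invariance [insubd] never takes its default value *)
Definition U_fun (j : 'I_n) (f : L2fun R n) : L2fun R n :=
  insubd 0 (fun t => (cos (tnth t j) +i* sin (tnth t j)) *
                     f (translate (fun l => pi * theta l j) t)).

Definition U (j : 'I_n) : H -> H := fun f => \pi_H%qT (U_fun j (repr f)).

(* negative powers of the unitary T are powers of T^-1 = T^* *)
Definition unitary_exp (T : H -> H) (m : int) : H -> H :=
  match m with
  | Posz p => iter p T
  | Negz p => iter p.+1 (adjoint T)
  end.

Definition Upow k : H -> H :=
  \big[(fun S T => S \o T)/id]_(j < n) unitary_exp (U j) (k 0 j).

Definition C_theta : set (H -> H) := smallest (@cstar_subalgebra R n) (range U).

Definition fourier x k : C := tau (x \o adjoint (Upow k)).

Definition freq_sqnorm k : R := \sum_(j < n) (k 0 j)%:~R ^+ 2.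

Definition rapidly_decaying (u : 'rV[int]_n -> C) : Prop :=
  forall N : nat, exists M : R,
    forall k, (1 + freq_sqnorm k) ^+ N * Re `|u k| <= M.

(* x = \sum_k u_k U^k, unconditionally in operator norm *)
Definition is_Fourier_sum (u : 'rV[int]_n -> C) x : Prop :=
  forall e : R, 0 < e -> exists F0 : {fset 'rV[int]_n},
    forall F : {fset 'rV[int]_n}, (F0 `<=` F)%fset ->
      (opnorm (x \- (fun f => \sum_(k <- F) u k *: Upow k f))%R < e%:E)%E.

Definition smooth : set (H -> H) :=
  [set x | C_theta x /\ exists2 u, rapidly_decaying u & is_Fourier_sum u x].

Definition sobolev_norm (s : R) x : R :=
  Num.sqrt (fine (\esum_(k in setT)
    ((1 + freq_sqnorm k) `^ s * Re `|fourier x k| ^+ 2)%:E)).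

End noncommutative_torus.

(* Main.v *)
(** Write [xi = x 1] for the image of the constant function, [c] for the norm of
    [xi] (the [L_2] norm of [x]), and [tau T = <T 1 | 1>].  Since
    [c <= ||x||_(W_2^s)], only a bound of the entropy by a constant times
    [||x||_(W_2^s)^2] is needed.

    Split [xi = y 1 + z] at the frequency box [|k_j| < 2^Q].  The low-frequency part
    [y 1 = sum u_k U^k 1] is also [Y 1], where [Y = sum u_k V_k] and the unitaries [V_k]
    commute with all [U_j] and satisfy [V_k 1 = U^k 1]; thus [Y] commutes with [x] and
    its norm is at most [lam = c 2^(n (Q+1))], by counting.  For a polynomial [b] with
    [0 <= b t <= t] on the spectrum of [x], commuting positivity (Riesz) gives
    [tau (Y b(x)) <= lam tau (b(x))], hence
    [tau ((x - 2 lam) b(x)) <= |z|^2 <= 4^(- s Q) ||x||_(W_2^s)^2].  Taking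
    [b t ~ t^3 / (t + lam)^2] and summing over [Q] bounds [tau (x^2 log (x^2 / c^2))],
    because [t^2 log (t^2 / c^2)] is dominated pointwise by a multiple of [t^2] plus a
    multiple of the sum of the [(t - 2 lam_Q) b_Q t].

    Spectral information is transferred to operators through polynomials only: the
    bottom of the numerical range of [q(x)] is an approximate eigenvalue, so by
    factoring over the complex numbers it is [q l] for an approximate eigenvalue [l]
    of [x]. *)

Require Import Defs.
From HB Require Import structures.
From mathcomp Require Import all_boot all_order all_algebra.
From mathcomp Require Import finmap generic_quotient ring_quotient.
From mathcomp Require Import all_classical all_reals all_analysis.
From mathcomp Require Import measurable_realfun complex zify ring lra.

Set Implicit Arguments.
Unset Strict Implicit.
Unset Printing Implicit Defensive.
Import Order.TTheory GRing.Theory Num.Theory.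
Import numFieldNormedType.Exports.

Local Open Scope classical_set_scope.
Local Open Scope ring_scope.
Local Open Scope complex_scope.

(** * Translation invariance of the torus measure *)

(** The obstacle is that [x] need not commute with its own Fourier truncation, so the scalar
    argument (low part bounded in sup norm, high part in L_2, cut at a height) has no pointwise
    meaning. Only the vector that the truncation makes out of [1] matters, and the commutant
    supplies another operator making the same vector. All estimates are uniform in theta, which
    enters only through unimodular phases and shifts. The logarithm comes from counting levels. With
    L = 2^n and lam_j = L^(j+1) c, each level well below t adds about t^2/2 to the sum of (t - 2
    lam_j) b_j(t), and there are about log(t/c) / log L such levels. On the operator side the same
    sum costs only a geometric series in 4^(-s). The constant is therefore 50 ln L + 4 ln L / (1 -
    4^(-s)), plus n/s |log a + 1| for the last term of the statement. The natural cutoff (t - lam)_+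
    is replaced by t^3 / (t + lam)^2: a truncated geometric series makes it an explicit polynomial
    up to a factor, and its cubic vanishing at 0 keeps the levels above t summable. *)

Section translation.
Variable R : realType.
Local Notation leb := (@lebesgue_measure R).

Definition line_shift (c : R) (x : measurableTypeR R) : measurableTypeR R := x + c.

Lemma measurable_shift (c : R) : measurable_fun setT (line_shift c).
Proof. by apply: measurable_funD => //; exact: measurable_cst. Qed.

HB.instance Definition _ (c : R) :=
  isMeasurableFun.Build _ _ _ _ (line_shift c) (measurable_shift c).

Lemma lebesgue_measure_shift (c : R) A : measurable A ->
  pushforward leb (line_shift c) A = leb A.
Proof.
move=> mA.
apply/esym; apply: (lebesgue_measure_unique (mu := pushforward leb (line_shift c))) => //.
move=> _ [[a b] _ <-]; rewrite /= /pushforward.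
rewrite (_ : _ @^-1` _ = [set` `]a - c, b - c]]); last first.
  by apply/seteqP; split => x /=; rewrite !in_itv/= /line_shift ltrBlDr lerBrDr.
rewrite !lebesgue_measure_itv/= !lte_fin ltrD2r; case: ifP => // _.
by congr (_%:E); rewrite opprB addrA subrK.
Qed.

Local Open Scope ereal_scope.

Lemma ge0_integral_shift (c : R) (D : set (measurableTypeR R))
    (f : measurableTypeR R -> \bar R) :
  measurable D -> measurable_fun setT f -> (forall x, 0 <= f x) ->
  \int[leb]_(x in [set x | D (x + c)%R]) f (x + c)%R = \int[leb]_(x in D) f x.
Proof.
move=> mD mf f0.
transitivity (\int[pushforward leb (line_shift c)]_(x in D) f x).
  have := @ge0_integral_pushforward _ _ _ _ _ _ (measurable_shift c) leb D f mD.
  by move=> -> //; apply: measurable_funTS.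
apply: eq_measure_integral => A mA _.
exact: lebesgue_measure_shift.
Qed.

(** Modulo the period the shift lies in [0, T[. The interval is then cut at T - c, and the shift
    exchanges the two arcs. *)
Lemma ge0_integral_period (T c : R) (f : measurableTypeR R -> \bar R) : (0 < T)%R ->
  measurable_fun setT f -> (forall x, 0 <= f x) ->
  (forall (m : int) (x : R), f (x + T * m%:~R)%R = f x) ->
  \int[leb]_(x in `[0%R, T]) f (x + c)%R = \int[leb]_(x in `[0%R, T]) f x.
Proof.
move=> T0 mf f0 pf.
have mfc d : measurable_fun [set: measurableTypeR R] (fun x : R => f (x + d)%R).
  by apply: (measurableT_comp mf); exact: measurable_shift.
wlog : c / (0 <= c < T)%R => [hw|/andP[c0 cT]].
  pose m := Num.floor (c / T); pose d := (c - T * m%:~R)%R.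
  have dT : (0 <= d < T)%R.
    have := floor_itv (c / T); rewrite -/m => /andP[h1 h2].
    rewrite /d subr_ge0 ltrBlDr mulrC -ler_pdivlMr// h1/=.
    have : (c / T < (m + 1)%:~R)%R by [].
    by rewrite ltr_pdivrMr// intrD mulrDl mul1r [(T + _)%R]addrC.
  rewrite -(hw d dT); apply: eq_integral => x _.
  by rewrite -[in RHS](pf m) /d; congr f; ring.
rewrite -!integral_itv_bndo_bndc;
  [|by apply: measurable_funTS|by apply: measurable_funTS (mfc c)].
have cut b (g : measurableTypeR R -> \bar R) : (0 <= b <= T)%R -> measurable_fun setT g ->
    (forall x, 0 <= g x) ->
    \int[leb]_(x in `[0%R, T[) g x =
    \int[leb]_(x in `[0%R, b[) g x + \int[leb]_(x in `[b, T[) g x.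
  move=> /andP[b0 bT] mg g0.
  have E : [set` `[0%R, T[] = [set` `[0%R, b[] `|` [set` `[b, T[].
    apply/seteqP; split=> x /=; rewrite !in_itv/=.
      by move=> /andP[-> ->]; case: (ltP x b) => _; [left|right].
    by move=> [/andP[-> /lt_le_trans -> //]|/andP[/(le_trans b0) -> ->]].
  rewrite E ge0_integral_setU//.
  - by apply: measurable_funTS.
  - rewrite disj_set2E; apply/eqP/seteqP; split => x //= [].
    by rewrite !in_itv/= => /andP[_ h1] /andP[]; rewrite leNgt h1.
rewrite (cut (T - c)%R (fun x => f (x + c)%R))//; last first.
  by rewrite subr_ge0 gerBl c0 ltW.
rewrite (cut c f)//; last by rewrite c0 ltW.
rewrite addeC; congr (_ + _).
  (* The arc [T - c, T[ is carried past [T] and comes back to [0, c[ by one period. *)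
  rewrite -(ge0_integral_shift (c - T)%R (D := [set` `[0%R, c[]))//.
  have -> : [set x | [set` `[0%R, c[] (x + (c - T))%R] = [set` `[(T - c)%R, T[].
    apply/seteqP; split=> x /=; rewrite !in_itv/= => /andP[? ?];
      by apply/andP; split; lra.
  apply: eq_integral => x _; rewrite -(pf 1%R (x + (c - T))%R).
  by congr f; rewrite mulr1; ring.
rewrite -(ge0_integral_shift c (D := [set` `[c, T[]))//.
congr (integral _ _ _); apply/seteqP; split=> x /=; rewrite !in_itv/= => /andP[? ?];
  by apply/andP; split; lra.
Qed.

Lemma circle_integral_shift (c : R) (f : measurableTypeR R -> \bar R) :
  measurable_fun setT f -> (forall x, 0 <= f x) ->
  (forall (m : int) (x : R), f (x + 2 * pi * m%:~R)%R = f x) ->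
  \int[circle_measure R]_x f (x + c)%R = \int[circle_measure R]_x f x.
Proof.
move=> mf f0 pf; rewrite /circle_measure /=.
rewrite (@integral_uniform _ _ _ (two_pi_gt0 R) (fun x => f (x + c)%R))//; last first.
  by apply: (measurableT_comp mf); exact: measurable_shift.
rewrite (@integral_uniform _ _ _ (two_pi_gt0 R) f)//.
by rewrite (ge0_integral_period c (two_pi_gt0 R)).
Qed.

Lemma measurable_translate n (c : 'I_n -> R) :
  measurable_fun setT (@translate R n c).
Proof.
apply/measurable_fun_tnthP => i.
rewrite (_ : _ \o _ = fun t => (tnth t i + c i)%R); last first.
  by apply/funext => t; rewrite /= tnth_mktuple.
exact: (measurableT_comp (measurable_shift (c i)) (measurable_tnth i)).
Qed.

Lemma translate_cons n (c : 'I_n.+1 -> R) (a : R) (t : Rn R n) :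
  translate c (Defs.cons_tuple (a, t)) =
  Defs.cons_tuple ((a + c ord0)%R, translate (fun i => c (lift ord0 i)) t).
Proof.
apply: eq_from_tnth => i; rewrite tnth_mktuple.
case: (unliftP ord0 i) => [j ->|->]; last by rewrite !tnth0.
by rewrite !tnthS tnth_mktuple.
Qed.

(** Nonnegativity allows Tonelli with no integrability condition. The induction peels off the first
    coordinate: the inner integral absorbs the shift of the others, and a periodic function on the
    circle remains. *)
Lemma torus_integral_shift n (c : 'I_n -> R) (F : Rn R n -> \bar R) :
  measurable_fun setT F -> (forall t, 0 <= F t) ->
  (forall (m : 'I_n -> int) t, F (translate (fun l => 2 * pi * (m l)%:~R)%R t) = F t) ->
  \int[torus_measure R n]_t F (translate c t) = \int[torus_measure R n]_t F t.
Proof.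
elim: n c F => [|n IH] c F mF F0 pF.
  by apply: eq_integral => t _; congr F; rewrite [LHS]tuple0 [RHS]tuple0.
have mFc : measurable_fun setT (F \o translate c).
  exact: measurableT_comp (measurable_translate c).
pose m2 := torus_measure R n.
rewrite -[LHS]/(\int[distribution (circle_measure R \x m2) (@Defs.cons_tuple R n)]_t
  (F \o translate c) t).
rewrite -[RHS]/(\int[distribution (circle_measure R \x m2) (@Defs.cons_tuple R n)]_t F t).
rewrite (ge0_integral_pushforward (@measurable_cons_tuple R n))//; last first.
  by move=> t _; rewrite /= F0.
rewrite (ge0_integral_pushforward (@measurable_cons_tuple R n))//.
rewrite preimage_setT.
have mG : measurable_fun setT (F \o @Defs.cons_tuple R n).
  exact: measurableT_comp (@measurable_cons_tuple R n).
have mGc : measurable_fun setT ((F \o translate c) \o @Defs.cons_tuple R n).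
  exact: measurableT_comp (@measurable_cons_tuple R n).
rewrite !fubini_tonelli1//; try (by move=> *; exact: F0).
pose G a := \int[m2]_t F (Defs.cons_tuple (a, t)).
transitivity (\int[circle_measure R]_a G (a + c ord0)%R).
  apply: eq_integral => a _; rewrite /fubini_F/=.
  under eq_integral do rewrite translate_cons.
  rewrite (IH _ (fun t => F (Defs.cons_tuple ((a + c ord0)%R, t))))//.
    apply: (measurableT_comp mG); apply: measurable_fun_pair => //; exact: measurable_cst.
  move=> m t.
  (* Periodicity in the remaining coordinates is joint periodicity along integer vectors whose first
     entry is 0. *)
  rewrite -[RHS](pF (fun i => if unlift ord0 i is Some j then m j else 0%R)).
  rewrite translate_cons unlift_none mulr0 addr0; congr (F (Defs.cons_tuple (_, _))).
  by congr translate; apply/funext => i; rewrite liftK.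
apply: circle_integral_shift.
- have h : @measurable_fun _ _ (measurableTypeR R) _ setT
      (fubini_F m2 (F \o @Defs.cons_tuple R n)).
    by apply: (@measurable_fun_fubini_tonelli_F _ _ _ _ R m2 _ mG) => x; exact: F0.
  exact h.
- by move=> a; exact: integral_ge0.
move=> m a; apply: eq_integral => t _.
rewrite -[RHS](pF (fun i => if unlift ord0 i is Some j then 0%R else m)).
rewrite translate_cons unlift_none; congr (F (Defs.cons_tuple (_, _))).
apply: eq_from_tnth => i; rewrite tnth_mktuple liftK.
by rewrite mulr0 addr0.
Qed.

End translation.

(** * The inner product of L_2 *)

Section inner_product.
Variables (R : realType) (n : nat).
Local Notation C := R[i].
Local Notation mu := (torus_measure R n).
Local Notation Re := (@complex.Re R).
Local Notation Im := (@complex.Im R).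
Local Notation H := (L2 R n).
Local Notation L2real := (Lfun mu 2%:E).

Definition real_ip (u v : Rn R n -> R) : R := \int[mu]_t (u t * v t).

Lemma measurable_L2real u : u \in L2real -> measurable_fun setT u.
Proof. by move=> /sub_Lfun_mfun; rewrite inE. Qed.

Lemma integrable_L2M u v : u \in L2real -> v \in L2real ->
  mu.-integrable setT (EFin \o (fun t => u t * v t)).
Proof. by move=> hu hv; apply/Lfun1_integrable; exact: Lfun2_mul_Lfun1. Qed.

Lemma real_ipC u v : real_ip u v = real_ip v u.
Proof. by apply: eq_Rintegral => t _; rewrite mulrC. Qed.

Lemma real_ip_linear a u v w : u \in L2real -> v \in L2real -> w \in L2real ->
  real_ip (fun t => a * u t + v t) w = a * real_ip u w + real_ip v w.
Proof.
move=> hu hv hw; rewrite /real_ip -RintegralZl//; last exact: integrable_L2M.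
rewrite -RintegralD//; last exact: integrable_L2M.
  by apply: eq_Rintegral => t _; rewrite mulrDl mulrA.
rewrite (_ : _ \o _ = (fun t => a%:E * (u t * w t)%:E)%E)//.
by apply: integrableZl => //; exact: integrable_L2M.
Qed.

Lemma real_ip_ge0 u : 0 <= real_ip u u.
Proof. by apply: Rintegral_ge0 => t _; rewrite -expr2 sqr_ge0. Qed.

Lemma real_ip_eq0 u : u \in L2real -> real_ip u u = 0 ->
  {ae mu, forall t, u t = 0}.
Proof.
move=> hu h0; have mu' := measurable_L2real hu.
have mf : measurable_fun setT (EFin \o (fun t => u t * u t)).
  by apply/measurable_EFinP; exact: measurable_funM.
have /(ae_eq_integral_abs mu measurableT mf) : (\int[mu]_t `|(u t * u t)%:E| = 0)%E.
  have fin := integrable_fin_num measurableT (integrable_L2M hu hu).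
  transitivity (\int[mu]_t (u t * u t)%:E)%E.
    by apply: eq_integral => t _; rewrite gee0_abs// lee_fin -expr2 sqr_ge0.
  by rewrite -(fineK fin) -[fine _]/(real_ip u u) h0.
apply: filterS => t /(_ I)/= /eqP; rewrite eqe mulf_eq0 => /orP[] /eqP //.
Qed.

Lemma real_ip_null u v : u \in L2real -> v \in L2real ->
  {ae mu, forall t, u t = 0} -> real_ip u v = 0.
Proof.
move=> hu hv u0; rewrite /real_ip /Rintegral.
rewrite (@ae_eq_integral _ _ _ mu setT (cst 0%E))//; first by rewrite integral0.
  by apply/measurable_EFinP; apply: measurable_funM; exact: measurable_L2real.
by apply: filterS u0 => t /= -> _; rewrite mul0r.
Qed.

Lemma Re_L2 (f : L2fun R n) : (Re \o L2val f) \in L2real.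
Proof. by case: f => f /= /and3P[]. Qed.

Lemma Im_L2 (f : L2fun R n) : (Im \o L2val f) \in L2real.
Proof. by case: f => f /= /and3P[]. Qed.

Lemma L2fun_periodic (f : L2fun R n) : Defs.periodic (L2val f).
Proof. by case: f => f /= /and3P[/asboolP]. Qed.

Definition fun_inner (f g : L2fun R n) : C :=
  complex_integral (fun t => f t * (g t)^*%C).

Lemma fun_innerE (f g : L2fun R n) : fun_inner f g =
  (real_ip (Re \o L2val f) (Re \o L2val g) + real_ip (Im \o L2val f) (Im \o L2val g)) +i*
  (real_ip (Im \o L2val f) (Re \o L2val g) - real_ip (Re \o L2val f) (Im \o L2val g)).
Proof.
rewrite /fun_inner /complex_integral; congr (_ +i* _).
  rewrite /real_ip -RintegralD//; last 2 first.
  - by apply: integrable_L2M; exact: Re_L2.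
  - by apply: integrable_L2M; exact: Im_L2.
  by apply: eq_Rintegral => t _ /=; case: (f t) (g t) => ? ? [? ?] /=; ring.
rewrite /real_ip -RintegralB//; last 2 first.
- by apply: integrable_L2M; [exact: Im_L2|exact: Re_L2].
- by apply: integrable_L2M; [exact: Re_L2|exact: Im_L2].
by apply: eq_Rintegral => t _ /=; case: (f t) (g t) => ? ? [? ?] /=; ring.
Qed.

Lemma fun_innerC f g : fun_inner g f = (fun_inner f g)^*%C.
Proof.
rewrite !fun_innerE /=; congr (_ +i* _); first by rewrite real_ipC [in X in _ + X]real_ipC.
by rewrite opprB real_ipC [in X in _ - X]real_ipC.
Qed.

Lemma fun_inner_linear a f g h :
  fun_inner (a *: f + g) h = a * fun_inner f h + fun_inner g h.
Proof.
have E1 : Re \o L2val (a *: f + g) =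
    (fun t => Re a * (Re \o L2val f) t +
      (fun t => - Im a * (Im \o L2val f) t + (Re \o L2val g) t) t).
  apply/funext => t; rewrite -[LHS]/(Re (a * f t + g t)) /=.
  by case: (f t) (g t) a => ? ? [? ?] [? ?] /=; ring.
have E2 : Im \o L2val (a *: f + g) =
    (fun t => Re a * (Im \o L2val f) t +
      (fun t => Im a * (Re \o L2val f) t + (Im \o L2val g) t) t).
  apply/funext => t; rewrite -[LHS]/(Im (a * f t + g t)) /=; clear E1.
  by case: (f t) (g t) a => ? ? [? ?] [? ?] /=; ring.
have hL b u v : u \in L2real -> v \in L2real ->
    (fun t => b * u t + v t) \in L2real.
  have [_ LD] := Lfun_submod_closed mu (lee1n 2 : (1 <= 2%:E :> \bar R)%E).
  by move=> hu hv; exact: LD.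
rewrite !fun_innerE E1 E2.
rewrite !real_ip_linear ?hL ?Re_L2 ?Im_L2//.
by clear E1 E2; case: a => [a b] /=; congr (_ +i* _); ring.
Qed.

Lemma fun_inner_eq0 f : fun_inner f f = 0 -> f \in @L2null R n.
Proof.
rewrite fun_innerE => -[/eqP]; rewrite paddr_eq0 ?real_ip_ge0//.
move=> /andP[/eqP/(real_ip_eq0 (Re_L2 f)) h1 /eqP/(real_ip_eq0 (Im_L2 f)) h2] _.
apply/asboolP; apply: filterS2 h1 h2 => t /=.
by case: (f t) => a b /= -> ->.
Qed.

Lemma fun_inner_null f g : f \in @L2null R n -> fun_inner f g = 0.
Proof.
move=> /asboolP f0; rewrite fun_innerE.
have h1 : {ae mu, forall t, (Re \o L2val f) t = 0} by apply: filterS f0 => t /= ->.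
have h2 : {ae mu, forall t, (Im \o L2val f) t = 0} by apply: filterS f0 => t /= ->.
by rewrite !real_ip_null ?Re_L2 ?Im_L2// subr0 addr0.
Qed.

Lemma pi_L2_eq (f g : L2fun R n) : (\pi_H%qT f = \pi_H%qT g) <-> f - g \in @L2null R n.
Proof. by rewrite Quotient.idealrBE; split => [/eqP|/eqP]. Qed.

Lemma inner_pi f g : inner (\pi_H%qT f) (\pi_H%qT g) = fun_inner f g.
Proof.
rewrite -[LHS]/(fun_inner (repr (\pi_H%qT f)) (repr (\pi_H%qT g))).
have e (h k : L2fun R n) : fun_inner (repr (\pi_H%qT h)) k = fun_inner h k.
  rewrite -[repr _](subrK h) -[_ + h]/(_ + h) -[X in X + h]scale1r fun_inner_linear.
  by rewrite mul1r fun_inner_null ?add0r//; apply/pi_L2_eq; rewrite reprK.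
by rewrite e fun_innerC e -fun_innerC.
Qed.

Lemma pi_L2_linear a (f g : L2fun R n) :
  a *: (\pi_H%qT f : H) + \pi_H%qT g = \pi_H%qT (a *: f + g).
Proof. by rewrite pi_L2D -pi_L2_scale. Qed.

Lemma inner_linear a (x y z : H) : inner (a *: x + y) z = a * inner x z + inner y z.
Proof.
elim/quotW: x => f; elim/quotW: y => g; elim/quotW: z => h.
by rewrite [_ + _]pi_L2_linear !inner_pi fun_inner_linear.
Qed.

Lemma innerC (x y : H) : inner y x = (inner x y)^*%C.
Proof.
by elim/quotW: x => f; elim/quotW: y => g; rewrite !inner_pi fun_innerC.
Qed.

Lemma inner_ge0 (x : H) : 0 <= inner x x.
Proof.
elim/quotW: x => f; rewrite inner_pi fun_innerE lecE /= real_ipC subrr eqxx/=.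
by rewrite addr_ge0 ?real_ip_ge0.
Qed.

Lemma inner_eq0 (x : H) : inner x x = 0 -> x = 0.
Proof.
elim/quotW: x => f; rewrite inner_pi => /fun_inner_eq0 h.
have -> : (0 : H) = \pi_H%qT (0 : L2fun R n).
  by apply: (addIr (\pi_H%qT 0)); rewrite add0r -pi_L2D addr0.
by apply/pi_L2_eq; rewrite subr0.
Qed.

End inner_product.

(** * Weyl operators *)

Section weyl.
Variables (R : realType) (n : nat).
Local Notation C := R[i].
Local Notation mu := (torus_measure R n).
Local Notation Re := (@complex.Re R).
Local Notation Im := (@complex.Im R).
Local Notation H := (L2 R n).
Implicit Types (k : 'rV[int]_n) (v w : 'I_n -> R).

Definition expi (r : R) : C := cos r +i* sin r.

Lemma expiD a b : expi (a + b) = expi a * expi b.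
Proof. by rewrite /expi cosD sinD; congr (_ +i* _); ring. Qed.

Lemma conjcM (z w : C) : (z * w)^*%C = z^*%C * w^*%C.
Proof. exact: rmorphM. Qed.

Lemma expi0 : expi 0 = 1.
Proof. by rewrite /expi cos0 sin0. Qed.

Lemma expiN a : expi (- a) = (expi a)^*%C.
Proof. by rewrite /expi cosN sinN. Qed.

Lemma expi_conj a : expi a * (expi a)^*%C = 1.
Proof. by rewrite -expiN -expiD subrr expi0. Qed.

Lemma expi_2pi (m : int) : expi (2 * pi * m%:~R) = 1.
Proof.
have hn (p : nat) : expi (2 * pi * p%:R) = 1.
  elim: p => [|p IH]; first by rewrite mulr0 expi0.
  rewrite -(natr1 p) mulrDr expiD IH mul1r mulr1 /expi mulr_natl.
  by rewrite cos2pi sin2pi.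
case: m => p; first exact: hn.
by rewrite NegzE intrN mulrN expiN hn conjc1.
Qed.

Definition dot k v : R := \sum_(j < n) (k 0 j)%:~R * v j.

Lemma dotDr k v w : dot k (fun j => v j + w j) = dot k v + dot k w.
Proof. by rewrite -big_split/=; apply: eq_bigr => j _; rewrite mulrDr. Qed.

Lemma dotDl k k' v : dot (k + k') v = dot k v + dot k' v.
Proof.
by rewrite -big_split/=; apply: eq_bigr => j _; rewrite !mxE intrD mulrDl.
Qed.

Lemma dotNl k v : dot (- k) v = - dot k v.
Proof. by rewrite -sumrN; apply: eq_bigr => j _; rewrite !mxE intrN mulNr. Qed.

Lemma dotNr k v : dot k (fun j => - v j) = - dot k v.
Proof. by rewrite -sumrN; apply: eq_bigr => j _; rewrite mulrN. Qed.

Lemma dot0l v : dot 0 v = 0.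
Proof. by apply: big1 => j _; rewrite mxE mul0r. Qed.

Lemma expi_dot_2pi k (m : 'I_n -> int) :
  expi (dot k (fun l => 2 * pi * (m l)%:~R)) = 1.
Proof.
rewrite (_ : dot _ _ = 2 * pi * (\sum_j k 0 j * m j)%:~R) ?expi_2pi//.
rewrite rmorph_sum /= mulr_sumr; apply: eq_bigr => j _.
by rewrite intrM; ring.
Qed.

Lemma dot_translate k v (t : Rn R n) :
  dot k (tnth (translate v t)) = dot k (tnth t) + dot k v.
Proof.
by rewrite -dotDr; apply: eq_bigr => j _; rewrite tnth_mktuple.
Qed.

Lemma translateD v w (t : Rn R n) :
  translate v (translate w t) = translate (fun j => w j + v j) t.
Proof. by apply: eq_from_tnth => j; rewrite !tnth_mktuple addrA. Qed.

Lemma translateC v w (t : Rn R n) :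
  translate v (translate w t) = translate w (translate v t).
Proof. by rewrite !translateD; congr translate; apply/funext => j; rewrite addrC. Qed.

Lemma translate0 (t : Rn R n) : translate (fun=> 0) t = t.
Proof. by apply: eq_from_tnth => j; rewrite !tnth_mktuple addr0. Qed.

(** Weyl operators: translation, modulation by a character, and a scalar. The family is closed under
    composition and contains the U_j, the U^k, their adjoints and the commutant operators, so one
    calculus serves them all. *)
Definition wfun (c : C) k v (f : Rn R n -> C) (t : Rn R n) : C :=
  c * expi (dot k (tnth t)) * f (translate v t).

Lemma wfun_periodic c k v f : Defs.periodic f -> Defs.periodic (wfun c k v f).
Proof.
move=> pf m t; rewrite /wfun dot_translate expiD expi_dot_2pi mulr1.
by rewrite translateC pf.
Qed.

Lemma L2realP (u : Rn R n -> R) : measurable_fun setT u ->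
  (\int[mu]_t (u t ^+ 2)%:E < +oo)%E -> u \in Lfun mu 2%:E.
Proof.
move=> mf u2; apply/andP; split; rewrite inE//= /finite_norm unlock /=.
apply: poweR_lty; apply: le_lt_trans u2.
rewrite le_eqVlt; apply/orP; left; apply/eqP; apply: eq_integral => t _.
by rewrite /= powR_mulrn ?normr_ge0// -normrX ger0_norm ?sqr_ge0.
Qed.

Lemma measurable_dot k : measurable_fun setT (fun t : Rn R n => dot k (tnth t)).
Proof.
apply: measurable_sum => j; apply: measurable_funM => //.
exact: (measurable_tnth j).
Qed.

Lemma measurable_wfun c k v (f : L2fun R n) :
  measurable_fun setT (Re \o wfun c k v f) /\
  measurable_fun setT (Im \o wfun c k v f).
Proof.
have mr : measurable_fun setT (Re \o L2val f \o translate v).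
  apply: (measurableT_comp _ (@measurable_translate R n v)).
  by apply: measurable_L2real; exact: Re_L2.
have mi : measurable_fun setT (Im \o L2val f \o translate v).
  apply: (measurableT_comp _ (@measurable_translate R n v)).
  by apply: measurable_L2real; exact: Im_L2.
have mc : measurable_fun setT (fun t : Rn R n => cos (dot k (tnth t)) : R).
  apply: (measurableT_comp _ (measurable_dot k)).
  by apply: continuous_measurable_fun; exact: continuous_cos.
have ms : measurable_fun setT (fun t : Rn R n => sin (dot k (tnth t)) : R).
  apply: (measurableT_comp _ (measurable_dot k)).
  by apply: continuous_measurable_fun; exact: continuous_sin.
case: c => a b; split.
  rewrite (_ : _ \o _ = fun t => (a * cos (dot k (tnth t)) - b * sin (dot k (tnth t))) *
     (Re \o L2val f \o translate v) t - (a * sin (dot k (tnth t)) + b * cos (dot k (tnth t)))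
     * (Im \o L2val f \o translate v) t); last first.
    by apply/funext => t; rewrite /= /wfun /expi; case: (L2val f _) => ? ? /=.
  by apply: measurable_funB; apply: measurable_funM => //;
    [apply: measurable_funB|apply: measurable_funD]; apply: measurable_funM.
rewrite (_ : _ \o _ = fun t => (a * cos (dot k (tnth t)) - b * sin (dot k (tnth t))) *
     (Im \o L2val f \o translate v) t + (a * sin (dot k (tnth t)) + b * cos (dot k (tnth t)))
     * (Re \o L2val f \o translate v) t); last first.
  by apply/funext => t; rewrite /= /wfun /expi; case: (L2val f _) => ? ? /=.
by apply: measurable_funD; apply: measurable_funM => //;
    [apply: measurable_funB|apply: measurable_funD]; apply: measurable_funM.
Qed.

Definition sqmod (z : C) : R := Re z ^+ 2 + Im z ^+ 2.

Lemma sqmodM z1 z2 : sqmod (z1 * z2) = sqmod z1 * sqmod z2.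
Proof. by case: z1 z2 => ? ? [? ?]; rewrite /sqmod /=; ring. Qed.

Lemma sqmod_expi a : sqmod (expi a) = 1.
Proof. exact: cos2Dsin2. Qed.

(** The squared modulus of the image is |c|^2 times a translate of that of [f], so its integral is
    finite by translation invariance; it dominates the squares of the real and imaginary parts. *)
Lemma wfun_sq_integrable c k v (f : L2fun R n) : wfun c k v f \in @sq_integrable R n.
Proof.
have [mr mi] := measurable_wfun c k v f.
have mRf : measurable_fun setT (Re \o L2val f) by exact: measurable_L2real (Re_L2 _).
have mIf : measurable_fun setT (Im \o L2val f) by exact: measurable_L2real (Im_L2 _).
have fin : (\int[mu]_t (sqmod (wfun c k v f t))%:E < +oo)%E.
  rewrite (eq_integral (fun t => ((sqmod c)%:E * (sqmod (f (translate v t)))%:E)%E));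
    last first.
    by move=> t _; rewrite /wfun !sqmodM sqmod_expi mulr1 EFinM.
  have mf : measurable_fun setT (fun t => (sqmod (f t))%:E : \bar R).
    by apply/measurable_EFinP; apply: measurable_funD; exact: measurable_funX.
  have sge z : (0 <= (sqmod z)%:E)%E by rewrite lee_fin addr_ge0 ?sqr_ge0.
  rewrite ge0_integralZl//; last first.
    by apply: (measurableT_comp mf); exact: measurable_translate.
  rewrite (torus_integral_shift v mf)//; last first.
    by move=> m t; rewrite (L2fun_periodic f m).
  apply: lte_mul_pinfty; rewrite ?sge//.
  rewrite (eq_integral (fun t => ((Re \o L2val f) t * (Re \o L2val f) t)%:E
     + ((Im \o L2val f) t * (Im \o L2val f) t)%:E)%E)//.
  rewrite integralD//; [|exact: (integrable_L2M (Re_L2 f) (Re_L2 f))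
                        |exact: (integrable_L2M (Im_L2 f) (Im_L2 f))].
  have flt (u : Rn R n -> R) : u \in Lfun mu 2%:E ->
      (\int[mu]_t (u t * u t)%:E < +oo)%E.
    move=> hu; rewrite ltey_eq.
    by rewrite (integrable_fin_num measurableT (integrable_L2M hu hu)).
  by apply: lte_add_pinfty; [exact: flt (Re_L2 f)|exact: flt (Im_L2 f)].
have msq : measurable_fun setT (fun t => (sqmod (wfun c k v f t))%:E : \bar R).
  by apply/measurable_EFinP; apply: measurable_funD; exact: measurable_funX.
apply/and3P; split; first by apply/asboolP/wfun_periodic/L2fun_periodic.
- apply: L2realP => //; apply: le_lt_trans fin; apply: ge0_le_integral => //.
  + by move=> t _; rewrite lee_fin sqr_ge0.
  + by apply/measurable_EFinP; exact: measurable_funX.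
  + by move=> t _; rewrite lee_fin lerDl sqr_ge0.
- apply: L2realP => //; apply: le_lt_trans fin; apply: ge0_le_integral => //.
  + by move=> t _; rewrite lee_fin sqr_ge0.
  + by apply/measurable_EFinP; exact: measurable_funX.
  + by move=> t _; rewrite lee_fin lerDr sqr_ge0.
Qed.

Definition weyl_fun c k v (f : L2fun R n) : L2fun R n :=
  MkL2fun (wfun_sq_integrable c k v f).

Lemma torus_Rintegral_shift v (h : Rn R n -> R) : measurable_fun setT h ->
  (forall (m : 'I_n -> int) t, h (translate (fun l => 2 * pi * (m l)%:~R) t) = h t) ->
  \int[mu]_t h (translate v t) = \int[mu]_t h t.
Proof.
move=> mh ph; rewrite /Rintegral; congr fine; rewrite integralE [RHS]integralE.
have mE : measurable_fun setT (EFin \o h) by exact/measurable_EFinP.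
have shiftE (F : Rn R n -> \bar R) : measurable_fun setT F -> (forall t, 0 <= F t)%E ->
    (forall (m : 'I_n -> int) t, F (translate (fun l => 2 * pi * (m l)%:~R) t) = F t) ->
    (\int[mu]_t F t = \int[mu]_t F (translate v t))%E.
  by move=> mF F0 pF; rewrite torus_integral_shift.
congr (_ - _)%E; rewrite [RHS]shiftE.
- by apply: eq_integral => t _; rewrite !funeposE.
- exact: measurable_funepos.
- by move=> t; exact: funepos_ge0.
- by move=> m t; rewrite !funeposE /= ph.
- by apply: eq_integral => t _; rewrite !funenegE.
- exact: measurable_funeneg.
- by move=> t; exact: funeneg_ge0.
- by move=> m t; rewrite !funenegE /= ph.
Qed.

Lemma weyl_fun_linear c k v a (f g : L2fun R n) :
  weyl_fun c k v (a *: f + g) = a *: weyl_fun c k v f + weyl_fun c k v g.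
Proof.
apply/val_inj/funext => t; rewrite -[LHS]/(wfun c k v (fun t => a * f t + g t) t).
rewrite -[RHS]/(a * wfun c k v f t + wfun c k v g t) /wfun; ring.
Qed.

Lemma weyl_funZ c k v (f : L2fun R n) :
  weyl_fun c k v f = c *: weyl_fun 1 k v f.
Proof.
apply/val_inj/funext => t; rewrite -[RHS]/(c * wfun 1 k v f t) /= /wfun.
by rewrite mul1r mulrA.
Qed.

(** The character cancels against its conjugate, which leaves the integral of a translate of f times
    the conjugate of g. *)
Lemma fun_inner_weyl c k v f g :
  fun_inner (weyl_fun c k v f) (weyl_fun c k v g) = c * c^*%C * fun_inner f g.
Proof.
have Zl a (u w : L2fun R n) : fun_inner (a *: u) w = a * fun_inner u w.
  by rewrite -[a *: u]addr0 fun_inner_linear -[0](subrr u) -[- u]scaleN1r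
    [u + _]addrC fun_inner_linear mulN1r addNr addr0.
rewrite [weyl_fun c k v f]weyl_funZ [weyl_fun c k v g]weyl_funZ Zl fun_innerC Zl.
rewrite conjcM -fun_innerC mulrA; congr (_ * _).
pose h t := L2val f t * (L2val g t)^*%C.
have mRf : measurable_fun setT (Re \o L2val f) by exact: measurable_L2real (Re_L2 _).
have mIf : measurable_fun setT (Im \o L2val f) by exact: measurable_L2real (Im_L2 _).
have mRg : measurable_fun setT (Re \o L2val g) by exact: measurable_L2real (Re_L2 _).
have mIg : measurable_fun setT (Im \o L2val g) by exact: measurable_L2real (Im_L2 _).
have ph : Defs.periodic h by move=> m t; rewrite /h !L2fun_periodic.
have -> : fun_inner (weyl_fun 1 k v f) (weyl_fun 1 k v g) =
    complex_integral (fun t => h (translate v t)).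
  rewrite /fun_inner; congr complex_integral; apply/funext => t /=.
  by rewrite /wfun !mul1r conjcM mulrACA expi_conj mul1r.
rewrite /fun_inner /complex_integral; congr (_ +i* _).
  rewrite (torus_Rintegral_shift v (h := fun t => Re (h t)))//.
  - rewrite (_ : (fun _ => _) = fun t => (Re \o L2val f) t * (Re \o L2val g) t
      + (Im \o L2val f) t * (Im \o L2val g) t); last first.
      by apply/funext => t; rewrite /h /=; case: (L2val f t) (L2val g t) => ? ? [? ?] /=; ring.
    by apply: measurable_funD; exact: measurable_funM.
  - by move=> m t; rewrite ph.
rewrite (torus_Rintegral_shift v (h := fun t => Im (h t)))//.
- rewrite (_ : (fun _ => _) = fun t => (Im \o L2val f) t * (Re \o L2val g) t
    - (Re \o L2val f) t * (Im \o L2val g) t); last first.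
    by apply/funext => t; rewrite /h /=; case: (L2val f t) (L2val g t) => ? ? [? ?] /=; ring.
  by apply: measurable_funB; exact: measurable_funM.
- by move=> m t; rewrite ph.
Qed.

Definition weyl c k v (x : H) : H := \pi_H%qT (weyl_fun c k v (repr x)).

(** Well-definedness on classes: a null difference has an image of norm 0 by [fun_inner_weyl], hence
    a null image. *)
Lemma weyl_pi c k v f : weyl c k v (\pi_H%qT f) = \pi_H%qT (weyl_fun c k v f).
Proof.
apply/pi_L2_eq.
have -> : weyl_fun c k v (repr (\pi_H%qT f)) - weyl_fun c k v f =
    weyl_fun c k v (repr (\pi_H%qT f) - f).
  by rewrite -scaleN1r addrC -weyl_fun_linear scaleN1r addrC.
apply: fun_inner_eq0; rewrite fun_inner_weyl fun_inner_null ?mulr0//.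
by apply/pi_L2_eq; rewrite reprK.
Qed.

Lemma weyl_linear c k v : linear (weyl c k v).
Proof.
move=> a; elim/quotW => f; elim/quotW => g.
by rewrite [_ + _]pi_L2_linear !weyl_pi weyl_fun_linear -pi_L2_linear.
Qed.

Lemma inner_weyl c k v (x y : H) :
  inner (weyl c k v x) (weyl c k v y) = c * c^*%C * inner x y.
Proof.
by elim/quotW: x => f; elim/quotW: y => g; rewrite !weyl_pi !inner_pi fun_inner_weyl.
Qed.

(** The phase arises when the outer translation meets the inner character; it is the only source of
    noncommutativity. *)
Lemma weyl_comp c k v c' k' v' (x : H) :
  weyl c k v (weyl c' k' v' x) =
  weyl (c * c' * expi (dot k' v)) (k + k') (fun j => v j + v' j) x.
Proof.
elim/quotW: x => f; rewrite (weyl_pi c' k' v' f) !weyl_pi; congr (\pi_H%qT _).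
apply/val_inj/funext => t; rewrite -[LHS]/(wfun c k v (wfun c' k' v' f) t).
rewrite -[RHS]/(wfun _ _ _ f t) /wfun dot_translate dotDl !expiD translateD.
ring.
Qed.

Lemma weyl1 (x : H) : weyl 1 0 (fun=> 0) x = x.
Proof.
elim/quotW: x => f; rewrite !weyl_pi; congr (\pi_H%qT _).
apply/val_inj/funext => t /=.
by rewrite /wfun dot0l expi0 !mul1r translate0.
Qed.

(** A constant function does not see translations. Hence operators with different shifts can agree
    at [1], which is what [commutant_one] rests on. *)
Lemma weyl_one_shift c k v : weyl c k v (L2one R n) = weyl c k (fun=> 0) (L2one R n).
Proof.
by rewrite !weyl_pi; congr (\pi_H%qT _); apply/val_inj/funext => t.
Qed.

Lemma weyl_scale c k v (x : H) : weyl c k v x = c *: weyl 1 k v x.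
Proof.
elim/quotW: x => f; rewrite !weyl_pi weyl_funZ.
by rewrite -[RHS]/(L2_scale c _) pi_L2_scale.
Qed.

End weyl.

(** * Approximate eigenvalues *)

Section hilbert.
Variables (R : realType) (n : nat).
Local Notation C := R[i].
Local Notation H := (L2 R n).
Local Notation Re := (@complex.Re R).
Local Notation Im := (@complex.Im R).
Local Notation N := (@L2norm R n).
Implicit Types (x y z f g h : H) (S T A B : H -> H).

Section linear_operator.
Variables (T : H -> H) (lT : linear T).

Lemma lin0 : T 0 = 0.
Proof.
by have := lT (-1) 0 0; rewrite scaleN1r oppr0 addr0 scaleN1r addNr.
Qed.

Lemma linZ a f : T (a *: f) = a *: T f.
Proof. by have := lT a f 0; rewrite !addr0 lin0 addr0. Qed.

Lemma linD f g : T (f + g) = T f + T g.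
Proof. by have := lT 1 f g; rewrite !scale1r. Qed.

Lemma linB f g : T (f - g) = T f - T g.
Proof. by rewrite linD -scaleN1r linZ scaleN1r. Qed.

Lemma lin_sum (I : Type) (r : seq I) (P : pred I) (F : I -> H) :
  T (\sum_(i <- r | P i) F i) = \sum_(i <- r | P i) T (F i).
Proof. by elim/big_rec2 : _ => [|i u v _ <-]; [exact: lin0|exact: linD]. Qed.

Lemma iter_linear i : linear (iter i T).
Proof. by elim: i => // i IH a f g /=; rewrite IH lT. Qed.

End linear_operator.

Definition re x y : R := Re (inner x y).

Lemma reC x y : re x y = re y x.
Proof. by rewrite /re innerC; case: (inner y x). Qed.

Lemma innerDl x y z : inner (x + y) z = inner x z + inner y z.
Proof. by rewrite -{1}[x]scale1r inner_linear mul1r. Qed.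

Lemma reDl x y z : re (x + y) z = re x z + re y z.
Proof. by rewrite /re innerDl; case: (inner x z) (inner y z) => ? ? [? ?]. Qed.

Lemma inner0l z : inner 0 z = 0.
Proof.
have := inner_linear 1 (0 : H) 0 z; rewrite scale1r addr0 mul1r => /eqP.
by rewrite -{1}[inner 0 z]addr0 (inj_eq (addrI _)) => /eqP.
Qed.

Lemma innerZl a x z : inner (a *: x) z = a * inner x z.
Proof. by rewrite -[a *: x]addr0 inner_linear inner0l addr0. Qed.

Lemma innerZr a x z : inner x (a *: z) = a^*%C * inner x z.
Proof. by rewrite innerC innerZl conjcM -innerC. Qed.

Lemma innerDr x y z : inner z (x + y) = inner z x + inner z y.
Proof. by rewrite innerC innerDl [inner z x]innerC [inner z y]innerC rmorphD. Qed.

Lemma innerBl x y z : inner (x - y) z = inner x z - inner y z.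
Proof. by rewrite innerDl -scaleN1r innerZl mulN1r. Qed.

Lemma innerBr x y z : inner z (x - y) = inner z x - inner z y.
Proof. by rewrite innerC innerBl [inner z x]innerC [inner z y]innerC rmorphB. Qed.

Lemma reZl (a : R) x y : re (a%:C *: x) y = a * re x y.
Proof. by rewrite /re innerZl; case: (inner x y) => ? ? /=; rewrite mul0r subr0. Qed.

Lemma reNl x y : re (- x) y = - re x y.
Proof.
have m1 : (-1 : C) = (-1)%:C by rewrite rmorphN1.
by rewrite -scaleN1r m1 reZl mulN1r.
Qed.

Lemma reBl x y z : re (x - y) z = re x z - re y z.
Proof. by rewrite reDl reNl. Qed.

Lemma reDr x y z : re z (x + y) = re z x + re z y.
Proof. by rewrite reC reDl ![re _ z]reC. Qed.

Lemma reBr x y z : re z (x - y) = re z x - re z y.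
Proof. by rewrite reC reBl ![re _ z]reC. Qed.

Lemma reZr (a : R) x y : re x (a%:C *: y) = a * re x y.
Proof. by rewrite reC reZl reC. Qed.

Lemma re_sum_l (I : Type) (r : seq I) (P : pred I) (F : I -> H) y :
  re (\sum_(i <- r | P i) F i) y = \sum_(i <- r | P i) re (F i) y.
Proof.
elim/big_rec2 : _ => [|i u v _ <-]; last by rewrite reDl.
by rewrite /re inner0l.
Qed.

Lemma re_ge0 x : 0 <= re x x.
Proof. by have := inner_ge0 x; rewrite lecE => /andP[]. Qed.

Lemma inner_re x : inner x x = (re x x)%:C.
Proof.
have /ger0_Im := inner_ge0 x; rewrite /re.
by case: (inner x x) => a b /= ->.
Qed.

Lemma re_eq0 x : re x x = 0 -> x = 0.
Proof. by move=> h; apply: inner_eq0; rewrite inner_re h. Qed.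

Lemma N_ge0 x : 0 <= N x. Proof. exact: sqrtr_ge0. Qed.

Lemma N_sqr x : N x ^+ 2 = re x x.
Proof. by rewrite sqr_sqrtr// re_ge0. Qed.

Lemma N0_eq0 x : N x = 0 -> x = 0.
Proof. by move=> h; apply: re_eq0; rewrite -N_sqr h expr0n. Qed.

Lemma N0 : N 0 = 0. Proof. by rewrite /L2norm inner0l sqrtr0. Qed.

Lemma N_le x (c : R) : 0 <= c -> re x x <= c ^+ 2 -> N x <= c.
Proof. by move=> c0; rewrite -N_sqr ler_sqr ?nnegrE ?N_ge0. Qed.

Definition modc (a : C) : R := Num.sqrt (sqmod a).

Lemma modc_ge0 a : 0 <= modc a. Proof. exact: sqrtr_ge0. Qed.

Lemma modc_sqr a : modc a ^+ 2 = sqmod a.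
Proof. by rewrite sqr_sqrtr// addr_ge0 ?sqr_ge0. Qed.

Lemma modcR (a : R) : 0 <= a -> modc a%:C = a.
Proof. by move=> a0; rewrite /modc /sqmod /= expr0n addr0 sqrtr_sqr ger0_norm. Qed.

Lemma N_scale a x : N (a *: x) = modc a * N x.
Proof.
apply/eqP; rewrite -(@eqrXn2 _ 2) ?mulr_ge0 ?N_ge0 ?modc_ge0//; apply/eqP.
rewrite exprMn !N_sqr modc_sqr /re innerZl innerZr inner_re.
by case: a => a b; rewrite /sqmod /=; ring.
Qed.

Lemma N_scaleR (a : R) x : 0 <= a -> N (a%:C *: x) = a * N x.
Proof.
by move=> a0; rewrite N_scale modcR.
Qed.

Lemma cauchy_schwarz x y : re x y <= N x * N y.
Proof.
have [y0|y0] := eqVneq (re y y) 0.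
  by rewrite (re_eq0 y0) reC /re inner0l mulr_ge0 ?N_ge0.
have yp : 0 < re y y by rewrite lt_def y0 re_ge0.
have h : re x y ^+ 2 <= re x x * re y y.
  pose t := re x y / re y y.
  have := re_ge0 (x - t%:C *: y); rewrite reBl !reBr !reZr !reZl (reC y x).
  have tE : t * re y y = re x y by rewrite divfK.
  have : re x x * re y y - re x y ^+ 2 =
     re y y * (re x x - t * re x y - (t * re x y - t * (t * re y y))).
    by rewrite tE subrr subr0 mulrBr mulrA [_ * t]mulrC tE; ring.
  by move=> E h; rewrite -subr_ge0 E mulr_ge0// ltW.
apply: le_trans (ler_norm _) _; rewrite -ler_sqr ?nnegrE ?mulr_ge0 ?N_ge0//.
by rewrite exprMn !N_sqr real_normK// num_real.
Qed.

Lemma NN x : N (- x) = N x.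
Proof.
by rewrite -scaleN1r N_scale /modc /sqmod /= sqrrN expr1n oppr0 expr0n addr0 sqrtr1 mul1r.
Qed.

Lemma cauchy_schwarz_norm x y : `|re x y| <= N x * N y.
Proof.
by rewrite ler_norml cauchy_schwarz andbT lerNl -reNl -NN cauchy_schwarz.
Qed.

Lemma N_add x y : N (x + y) <= N x + N y.
Proof.
apply: N_le; first by rewrite addr_ge0 ?N_ge0.
rewrite sqrrD !N_sqr reDl !reDr (reC y x).
have := cauchy_schwarz x y; lra.
Qed.

Lemma N_sub x y : N x - N y <= N (x - y).
Proof. by have := N_add (x - y) y; rewrite subrK; lra. Qed.

Lemma N_sum (I : Type) (r : seq I) (P : pred I) (F : I -> H) :
  N (\sum_(i <- r | P i) F i) <= \sum_(i <- r | P i) N (F i).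
Proof.
elim/big_rec2 : _ => [|i u v _ h].
  by rewrite N0.
by apply: le_trans (N_add _ _) _; rewrite lerD2l.
Qed.

Definition lip T (M : R) := forall f, N (T f) <= M * N f.

Lemma opnorm_lip T (e : R) : linear T -> (opnorm T < e%:E)%E -> lip T e.
Proof.
move=> lT oT f.
have [f0|f0] := eqVneq (N f) 0.
  have -> : T f = 0 by rewrite (N0_eq0 f0) lin0.
  by rewrite f0 mulr0 N0.
have fp : 0 < N f by rewrite lt_def f0 N_ge0.
have h : ((N (T ((N f)^-1%:C *: f)))%:E <= opnorm T)%E.
  apply: ereal_sup_ubound; exists ((N f)^-1%:C *: f) => //=.
  by rewrite N_scaleR ?invr_ge0 ?N_ge0// mulVf.
have := le_lt_trans h oT; rewrite lte_fin (linZ lT) N_scaleR ?invr_ge0 ?N_ge0//.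
by rewrite mulrC ltr_pdivrMr// => /ltW.
Qed.

Lemma bounded_op_lip T : bounded_op T -> linear T /\ exists2 M : R, 0 <= M & lip T M.
Proof.
move=> [lT oT]; split => //.
have o0 : (0 <= opnorm T)%E.
  apply: le_trans (ereal_sup_ubound _); last by exists 0 => //=; rewrite N0.
  by rewrite lee_fin N_ge0.
exists (fine (opnorm T) + 1); first by rewrite addr_ge0// fine_ge0.
apply: opnorm_lip => //.
by rewrite -[opnorm T]fineK ?ge0_fin_numE// lte_fin ltrDl.
Qed.

Lemma selfadjoint_re T : selfadjoint T -> forall f g, re (T f) g = re f (T g).
Proof. by move=> sT f g; rewrite /re sT. Qed.

Lemma inner_separate x y : (forall z, inner x z = inner y z) -> x = y.
Proof.
move=> h; apply/eqP; rewrite -subr_eq0; apply/eqP/re_eq0.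
by rewrite reBl /re h subrr.
Qed.

Lemma selfadjoint_linear T : selfadjoint T -> linear T.
Proof.
by move=> sT a f g; apply: inner_separate => z; rewrite sT !inner_linear !sT.
Qed.

(** Weyl sequences in place of resolvents: such an [l] lies in the spectrum, and the infimum of the
    quadratic form of a bounded selfadjoint operator is of this kind. *)
Definition approx_eig T (l : C) := forall e : R, 0 < e ->
  exists2 f, N f = 1 & N (T f - l *: f) < e.

Lemma not_approx_eig T l : linear T -> ~ approx_eig T l ->
  exists2 e : R, 0 < e & forall f, e * N f <= N (T f - l *: f).
Proof.
move=> lT /existsNP[e /not_implyP[e0 he]]; exists e => // f.
have [f0|f0] := eqVneq (N f) 0; first by rewrite f0 mulr0 N_ge0.
have fp : 0 < N f by rewrite lt_def f0 N_ge0.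
have fi : 0 <= (N f)^-1 by rewrite invr_ge0 N_ge0.
rewrite leNgt; apply/negP => hlt; apply: he; exists ((N f)^-1%:C *: f).
  by rewrite N_scaleR// mulVf.
rewrite (linZ lT) scalerA [l * _]mulrC -scalerA -scalerBr N_scaleR//.
by rewrite mulrC ltr_pdivrMr.
Qed.

Lemma approx_eig_spectrum T l : linear T -> approx_eig T l -> spectrum T l.
Proof.
move=> lT al [S [bS ST _]]; have [lS [M M0 hM]] := bounded_op_lip bS.
have Mp : 0 < M + 1 by rewrite ltr_wpDl.
have [|f f1 hf] := al (M + 1)^-1; first by rewrite invr_gt0.
have := hM (l *: f - T f).
have -> : S (l *: f - T f) = f by rewrite -[LHS]/((S \o (l \*: id \- T)) f) ST.
rewrite f1 -NN opprB => h.
have : M * N (T f - l *: f) < 1.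
  have h2 : (M + 1) * N (T f - l *: f) < 1 by rewrite mulrC -ltr_pdivlMr// div1r.
  by apply: le_lt_trans h2; rewrite ler_wpM2r ?N_ge0// lerDl.
by lra.
Qed.

(** With m the infimum of the form, P = A - m is positive and bounded, so |P f|^2 <= K' <P f, f>.
    Unit vectors that nearly minimize the form are therefore approximate eigenvectors. *)
Lemma approx_eig_inf A K : selfadjoint A -> lip A K -> (exists f, N f = 1) ->
  exists2 m : R, approx_eig A m%:C & forall f, N f = 1 -> m <= re (A f) f.
Proof.
move=> sA hK [f0 f01].
have lA := selfadjoint_linear sA.
pose E := [set re (A f) f | f in [set f | N f = 1]].
have lbE f : N f = 1 -> - K <= re (A f) f.
  move=> f1; have := cauchy_schwarz_norm (A f) f; rewrite f1 mulr1.
  by have := hK f; rewrite f1 ler_norml => ? /andP[? ?]; lra.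
have hE : has_inf E.
  split; first by exists (re (A f0) f0), f0.
  by exists (- K) => _ [f f1 <-]; exact: lbE.
have mE f : N f = 1 -> inf E <= re (A f) f.
  by move=> f1; apply: ge_inf; [exact: hE.2|exists f].
exists (inf E) => //; set m := inf E in mE *.
have hP f : m * re f f <= re (A f) f.
  have [f00|f00] := eqVneq (N f) 0.
    by rewrite (N0_eq0 f00) [re 0 0]/re [re _ 0]reC [re 0 _]/re !inner0l mulr0.
  have fp : 0 < N f by rewrite lt_def f00 N_ge0.
  have fi : 0 <= (N f)^-1 by rewrite invr_ge0 N_ge0.
  have := mE ((N f)^-1%:C *: f); rewrite N_scaleR// mulVf// => /(_ erefl).
  rewrite (linZ lA) reZl reZr mulrA -expr2 exprVn N_sqr.
  by rewrite [_^-1 * _]mulrC ler_pdivlMr// -N_sqr exprn_gt0.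
pose P f := A f - m%:C *: f.
have P_ge0 f : 0 <= re (P f) f by rewrite reBl reZl subr_ge0.
have K0 : 0 <= K by have := hK f0; rewrite f01 mulr1; apply: le_trans; exact: N_ge0.
pose K' := K + `|m| + 1.
have K'p : 0 < K' by rewrite /K' ltr_wpDl// addr_ge0.
have P_le f : re (P f) f <= K' * re f f.
  rewrite reBl reZl /K' -N_sqr.
  have h1 : re (A f) f <= K * N f ^+ 2.
    apply: le_trans (cauchy_schwarz _ _) _.
    by rewrite expr2 mulrA ler_wpM2r ?N_ge0.
  have h2 : - m * N f ^+ 2 <= `|m| * N f ^+ 2.
    by rewrite ler_wpM2r ?sqr_ge0// -normrN ler_norm.
  by have := sqr_ge0 (N f); move: h1 h2; lra.
have PB f g : P (f - g) = P f - P g.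
  rewrite /P scalerBr.
  by rewrite (linB lA) !opprB addrACA [RHS]addrACA; congr (_ + _); rewrite addrC.
have PZ (a : R) f : P (a%:C *: f) = a%:C *: P f.
  rewrite /P scalerBr scalerA [m%:C * _]mulrC -scalerA.
  by rewrite (linZ lA).
have Psa f g : re (P f) g = re f (P g).
  by rewrite reBl reBr reZl reZr (selfadjoint_re sA).
(* Positivity of [P] at f - P f / K' yields this bound without taking a square root of [P]. *)
have key f : N (P f) ^+ 2 <= K' * re (P f) f.
  have := P_ge0 (f - K'^-1%:C *: P f).
  rewrite PB PZ reBl !reBr !reZl !reZr (Psa (P f) f) -!N_sqr.
  have := P_le (P f); rewrite -N_sqr.
  set a := N (P f) ^+ 2; set b := re (P (P f)) (P f); set c := re (P f) f.
  move=> h1 h2.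
  have h3 : K'^-1 * b <= a by rewrite mulrC ler_pdivrMr// mulrC.
  have h4 : K'^-1 * (K'^-1 * b) <= K'^-1 * a by rewrite ler_wpM2l// invr_ge0 ltW.
  have h5 : K'^-1 * a <= c by move: h2 h4; lra.
  by move: h5; rewrite mulrC ler_pdivrMr// mulrC.
move=> e e0.
have d0 : 0 < e ^+ 2 / (K' * 2) by rewrite divr_gt0 ?exprn_gt0// mulr_gt0.
have [_ [f f1 <-] hf] := inf_adherent d0 hE.
exists f => //; rewrite -/(P f) -ltr_sqr ?nnegrE ?N_ge0// ?(ltW e0)//.
apply: le_lt_trans (key f) _.
have hc : re (P f) f < e ^+ 2 / (K' * 2).
  by rewrite reBl reZl -N_sqr f1 expr1n mulr1; move: hf; rewrite -/m; lra.
have : K' * re (P f) f < K' * (e ^+ 2 / (K' * 2)) by rewrite ltr_pM2l.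
have -> : K' * (e ^+ 2 / (K' * 2)) = e ^+ 2 / 2.
  by rewrite invfM mulrCA mulVKf ?gt_eqF.
have : 0 < e ^+ 2 by exact: exprn_gt0.
by move=> ? ?; lra.
Qed.

End hilbert.

(** * Polynomial calculus and commuting positivity *)

Section polynomial_calculus.
Variables (R : realType) (n : nat).
Local Notation C := R[i].
Local Notation H := (L2 R n).
Local Notation N := (@L2norm R n).
Implicit Types (f g h : H) (S T A B : H -> H).

Lemma lip_iter T M i : 0 <= M -> lip T M -> lip (iter i T) (M ^+ i).
Proof.
move=> M0 hM; elim: i => [|i IH] f /=; first by rewrite expr0 mul1r.
apply: le_trans (hM _) _; rewrite exprS -mulrA; exact: ler_wpM2l.
Qed.

(** Complex coefficients are needed for the splitting into linear factors in [poly_op_ge0]. *)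
Definition cpoly_op (p : {poly C}) T f : H := \sum_(i < size p) p`_i *: iter i T f.

Lemma cpoly_op_widen m (p : {poly C}) T f : (size p <= m)%N ->
  cpoly_op p T f = \sum_(i < m) p`_i *: iter i T f.
Proof.
move=> pm; rewrite /cpoly_op (big_ord_widen m (fun i => p`_i *: iter i T f))//.
rewrite big_mkcond; apply: eq_bigr => i _; case: ltnP => // h.
by rewrite nth_default// scale0r.
Qed.

Lemma cpoly_opD p q T f : cpoly_op (p + q) T f = cpoly_op p T f + cpoly_op q T f.
Proof.
have h := leq_maxl (size p) (size q); have h' := leq_maxr (size p) (size q).
rewrite (cpoly_op_widen _ _ (size_polyD p q)) (cpoly_op_widen _ _ h) (cpoly_op_widen _ _ h').
by rewrite -big_split; apply: eq_bigr => i _; rewrite coefD scalerDl.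
Qed.

Lemma cpoly_opZ a p T f : cpoly_op (a *: p) T f = a *: cpoly_op p T f.
Proof.
rewrite (cpoly_op_widen _ _ (size_scale_leq a p)) /cpoly_op scaler_sumr.
by apply: eq_bigr => i _; rewrite coefZ scalerA.
Qed.

Lemma cpoly_opC a T f : cpoly_op a%:P T f = a *: f.
Proof.
by rewrite (cpoly_op_widen _ _ (size_polyC_leq1 a)) big_ord1 coefC.
Qed.

Lemma cpoly_opMX p T f : cpoly_op (p * 'X) T f = cpoly_op p T (T f).
Proof.
have h : (size (p * 'X)%R <= (size p).+1)%N.
  by apply: leq_trans (size_polyMleq _ _) _; rewrite size_polyX addn2.
rewrite (cpoly_op_widen _ _ h) big_ord_recl coefMX eqxx scale0r add0r.
by apply: eq_bigr => i _; rewrite coefMX /= -iterSr.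
Qed.

Lemma cpoly_op_linear p T : linear T -> linear (cpoly_op p T).
Proof.
move=> lT a f g; rewrite /cpoly_op scaler_sumr -big_split; apply: eq_bigr => i _ /=.
by rewrite (iter_linear lT) scalerDr !scalerA mulrC.
Qed.

Lemma cpoly_op_comm p S T f : linear S -> (forall g, S (T g) = T (S g)) ->
  S (cpoly_op p T f) = cpoly_op p T (S f).
Proof.
move=> lS ST; rewrite /cpoly_op (lin_sum lS); apply: eq_bigr => i _.
by rewrite (linZ lS); congr (_ *: _); elim: (i : nat) => //= j IH; rewrite ST IH.
Qed.

Lemma cpoly_opM p q T f : linear T ->
  cpoly_op (p * q) T f = cpoly_op p T (cpoly_op q T f).
Proof.
move=> lT; elim/poly_ind: p f => [|p c IH] f.
  by rewrite mul0r -[0 in RHS](polyC0) cpoly_opC scale0r -polyC0 cpoly_opC scale0r.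
rewrite mulrDl !cpoly_opD mul_polyC cpoly_opZ cpoly_opC; congr (_ + _).
by rewrite mulrAC !cpoly_opMX IH; congr cpoly_op; rewrite (cpoly_op_comm _ _ lT).
Qed.

Lemma cpoly_op_XsubC z T f : cpoly_op ('X - z%:P) T f = T f - z *: f.
Proof.
rewrite -polyCN cpoly_opD cpoly_opC scaleNr -['X]mul1r cpoly_opMX.
by rewrite -polyC1 cpoly_opC scale1r.
Qed.

Lemma lip_cpoly_op p T M : linear T -> 0 <= M -> lip T M ->
  exists2 K : R, 0 <= K & lip (cpoly_op p T) K.
Proof.
move=> lT M0 hM; exists (\sum_(i < size p) modc p`_i * M ^+ i).
  by apply: sumr_ge0 => i _; rewrite mulr_ge0 ?modc_ge0 ?exprn_ge0.
move=> f; apply: le_trans (N_sum _ _ _) _; rewrite mulr_suml; apply: ler_sum => i _.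
by rewrite N_scale -mulrA ler_wpM2l ?modc_ge0//; exact: lip_iter.
Qed.

Lemma poly_opE (p : {poly R}) T f :
  poly_op p T f = cpoly_op (map_poly (real_complex R) p) T f.
Proof.
rewrite /cpoly_op size_map_poly; apply: eq_bigr => i _.
by rewrite coef_map.
Qed.

Lemma poly_opD (p q : {poly R}) T f : poly_op (p + q) T f = poly_op p T f + poly_op q T f.
Proof. by rewrite !poly_opE rmorphD cpoly_opD. Qed.

Lemma poly_opZ (a : R) (p : {poly R}) T f : poly_op (a *: p) T f = a%:C *: poly_op p T f.
Proof. by rewrite !poly_opE map_polyZ cpoly_opZ. Qed.

Lemma poly_opB (p q : {poly R}) T f : poly_op (p - q) T f = poly_op p T f - poly_op q T f.
Proof. by rewrite poly_opD -[- q]scaleN1r poly_opZ rmorphN1 scaleN1r. Qed.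

Lemma poly_opM (p q : {poly R}) T f : linear T ->
  poly_op (p * q) T f = poly_op p T (poly_op q T f).
Proof. by move=> lT; rewrite !poly_opE rmorphM cpoly_opM. Qed.

Lemma poly_opC (a : R) T f : poly_op a%:P T f = a%:C *: f.
Proof. by rewrite poly_opE map_polyC cpoly_opC. Qed.

Lemma poly_opX T f : poly_op 'X T f = T f.
Proof. by rewrite poly_opE map_polyX -['X]mul1r cpoly_opMX -polyC1 cpoly_opC scale1r. Qed.

Lemma poly_op_linear (p : {poly R}) T : linear T -> linear (poly_op p T).
Proof. by move=> lT a f g; rewrite !poly_opE (cpoly_op_linear _ lT). Qed.

Lemma poly_op_comm (p : {poly R}) S T f : linear S -> (forall g, S (T g) = T (S g)) ->
  S (poly_op p T f) = poly_op p T (S f).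
Proof. by move=> lS ST; rewrite !poly_opE cpoly_op_comm. Qed.

Lemma poly_op_sum (I : Type) (r : seq I) (F : I -> {poly R}) T f :
  poly_op (\sum_(i <- r) F i) T f = \sum_(i <- r) poly_op (F i) T f.
Proof.
elim/big_rec2 : _ => [|i u v _ <-]; last by rewrite poly_opD.
by rewrite -polyC0 poly_opC scale0r.
Qed.

Lemma poly_op_selfadjoint (p : {poly R}) T : selfadjoint T -> selfadjoint (poly_op p T).
Proof.
move=> sT f g.
have sI i h k : inner (iter i T h) k = inner h (iter i T k).
  by elim: i h k => // i IH h k; rewrite iterS iterSr sT IH.
rewrite /poly_op; elim/big_rec2 : _ => [|i u v _ h].
  by rewrite inner0l innerC inner0l conjc0.
by rewrite innerDl innerDr h innerZl innerZr sI conjc_real.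
Qed.

(** Each T - z is bounded below, and lower bounds multiply along a composition. *)
Lemma prod_XsubC_lower_bound T (r : seq C) : linear T ->
  (forall z, z \in r -> ~ approx_eig T z) ->
  exists2 d : R, 0 < d &
    forall f, d * N f <= N (cpoly_op (\prod_(z <- r) ('X - z%:P)) T f).
Proof.
move=> lT; elim: r => [|z r IH] hr.
  by exists 1 => // f; rewrite big_nil -polyC1 cpoly_opC scale1r mul1r.
have [|d d0 hd] := IH; first by move=> w wr; apply: hr; rewrite inE wr orbT.
have [|e e0 he] := @not_approx_eig _ _ T z lT; first by apply: hr; rewrite inE eqxx.
exists (e * d); first exact: mulr_gt0.
move=> f; rewrite big_cons cpoly_opM// cpoly_op_XsubC.
by apply: le_trans (he _); rewrite -mulrA ler_pM2l.
Qed.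

(* The bottom [m] of the numerical range of [q(T)] is an approximate eigenvalue;
   factoring [q - m] over the complex numbers yields an approximate eigenvalue [w]
   of [T] with [q(w) = m]. *)
Lemma poly_op_ge0 T M (q : {poly R}) : selfadjoint T -> 0 <= M -> lip T M ->
  (forall l, approx_eig T l -> exists2 r : R, l = r%:C & 0 <= q.[r]) ->
  forall f, 0 <= re (poly_op q T f) f.
Proof.
move=> sT M0 hM hq f; rewrite leNgt; apply/negP => neg.
have lT := selfadjoint_linear sT.
have sA := poly_op_selfadjoint q sT.
have lA := poly_op_linear q lT.
have [K K0 hK'] := lip_cpoly_op (map_poly (real_complex R) q) lT M0 hM.
have hK : lip (poly_op q T) K by move=> g; rewrite poly_opE.
have fn0 : N f != 0.
  apply/eqP => /N0_eq0 f0; move: neg.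
  by rewrite f0 (lin0 lA) /re inner0l ltxx.
have fp : 0 < N f by rewrite lt_def fn0 N_ge0.
have fi : 0 <= (N f)^-1 by rewrite invr_ge0 N_ge0.
pose u := (N f)^-1%:C *: f.
have u1 : N u = 1 by rewrite N_scaleR// mulVf.
have neg' : re (poly_op q T u) u < 0.
  rewrite (linZ lA) reZl reZr !pmulr_rlt0 ?invr_gt0//.
have ex1 : exists f, N f = 1 by exists u.
have [m am hm] := approx_eig_inf sA hK ex1.
have m0 : m < 0 by apply: le_lt_trans neg'; exact: hm.
pose qc := map_poly (real_complex R) (q - m%:P).
have qcE g : cpoly_op qc T g = poly_op q T g - m%:C *: g.
  by rewrite -poly_opE poly_opB poly_opC.
have qr (w : R) : qc.[w%:C] = (q.[w] - m)%:C.
  by rewrite horner_map /= hornerD hornerN hornerC.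
(* If q - m is zero, then q is the constant m < 0, against its sign at an approximate eigenvalue of
   [T]; [approx_eig_inf] provides one. *)
have [qc0|qc0] := eqVneq qc 0.
  have [l al _] := approx_eig_inf sT hM ex1.
  have [r [rE] qr0] := hq _ al.
  have := qr r; rewrite qc0 horner0 => -[]; lra.
have [r rE] := closed_field_poly_normal qc.
(* If no root were an approximate eigenvalue of [T], then q(T) - m would be bounded below, contrary
   to [am]. *)
have [h|h] := pselect (forall z, z \in r -> ~ approx_eig T z).
  have [d d0 hd] := prod_XsubC_lower_bound lT h.
  have c0 : 0 < modc (lead_coef qc).
    rewrite lt_def modc_ge0 andbT; apply/eqP => c0.
    have := lead_coef_eq0 qc; rewrite (negbTE qc0) => /eqP; apply.
    move: c0; rewrite /modc => /eqP; rewrite sqrtr_eq0 /sqmod.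
    case: (lead_coef qc) => a b /= ab.
    have : a ^+ 2 + b ^+ 2 == 0 by rewrite eq_le ab addr_ge0 ?sqr_ge0.
    by rewrite paddr_eq0 ?sqr_ge0// !sqrf_eq0 => /andP[/eqP -> /eqP ->].
  have [|g g1 hg] := am (modc (lead_coef qc) * d); first exact: mulr_gt0.
  move: hg; rewrite -qcE {1}rE cpoly_opZ N_scale ltr_pM2l//.
  by have := hd g; rewrite g1 mulr1 => h1 h2; have := le_lt_trans h1 h2; rewrite ltxx.
have /existsNP[z /not_implyP[zr /contrapT az]] := h.
have [w zE qw] := hq _ az.
have : qc.[z] = 0.
  by rewrite rE hornerZ horner_prod (big_rem z)//= hornerXsubC subrr mul0r mulr0.
by rewrite zE qr => -[]; lra.
Qed.

Lemma approx_eig_le T M (r : R) : lip T M -> approx_eig T r%:C -> r <= M.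
Proof.
move=> hM ar; rewrite leNgt; apply/negP => Mr.
have [|f f1 hf] := ar (r - M); first by rewrite subr_gt0.
have [r0|r0] := leP 0 r; last first.
  by have := hM f; rewrite f1 mulr1 => h; have := N_ge0 (T f); lra.
have := N_sub (r%:C *: f) (T f); rewrite N_scaleR// f1 -[N (_ - _)]NN opprB.
by have := hM f; rewrite f1; lra.
Qed.

(* Riesz: with [A_0 = A] and [A_(k+1) = A_k - A_k^2] one has
   [A = A_0^2 + ... + A_(k-1)^2 + A_k] and [A_k h -> 0]. *)
Lemma commuting_product_le A Y (lam K : R) h : selfadjoint A -> linear Y -> 0 <= K ->
  lip Y K -> (forall f, Y (A f) = A (Y f)) ->
  (forall f, 0 <= re (A f) f <= re f f) ->
  (forall f, re (Y f) f <= lam * re f f) ->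
  re (Y (A h)) h <= lam * re (A h) h.
Proof.
move=> sA lY K0 hY YA A01 Ylam.
pose B := fix B k : H -> H := if k is j.+1 then fun f => B j f - B j (B j f) else A.
have inv k : [/\ selfadjoint (B k), forall f, Y (B k f) = B k (Y f)
    & forall f, 0 <= re (B k f) f <= re f f].
  elim: k => [//|k [sB YB B01]] /=.
  have lB := selfadjoint_linear sB.
  have sBr := selfadjoint_re sB.
  split.
  - by move=> f g; rewrite innerBl innerBr !sB.
  - by move=> f; rewrite (linB lY) !YB.
  - move=> f; apply/andP; split; last first.
      rewrite reBl [re (B k (B k f)) f]sBr.
      by have := re_ge0 (B k f); have /andP[] := B01 f; lra.
    (* A - A^2 = A (1 - A)^2 + (1 - A) A^2 *)
    have -> : re (B k f - B k (B k f)) f =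
       re (B k (f - B k f)) (f - B k f) +
       (re (B k f) (B k f) - re (B k (B k f)) (B k f)).
      rewrite (linB lB) !reBl !reBr; rewrite -![re _ (B k f)]sBr; lra.
    have /andP[h1 _] := B01 (f - B k f); have /andP[_ h2] := B01 (B k f).
    by lra.
(* This defect decreases: D_k - D_(k+1) = lam |A_k h|^2 - Re <Y A_k h, A_k h>, which is nonnegative
   by the bound on [Y]. *)
pose D k := lam * re (B k h) h - re (Y (B k h)) h.
have Ddec k : D k.+1 <= D k.
  have [sB YB _] := inv k; have sBr := selfadjoint_re sB.
  rewrite /D /= (linB lY) !reBl.
  have -> : re (B k (B k h)) h = re (B k h) (B k h) by rewrite sBr.
  have -> : re (Y (B k (B k h))) h = re (Y (B k h)) (B k h) by rewrite YB sBr.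
  by have := Ylam (B k h); lra.
have D0 k : D k <= D 0%N by elim: k => // k IH; exact: le_trans IH.
have tele k : \sum_(i < k) re (B i h) (B i h) <= re (A h) h.
  have -> : \sum_(i < k) re (B i h) (B i h) = re (A h) h - re (B k h) h.
    elim: k => [|k IH]; first by rewrite big_ord0 subrr.
    have [sB _ _] := inv k.
    rewrite big_ord_recr /= IH reBl [re (B k (B k h)) h](selfadjoint_re sB); lra.
  by have [_ _ /(_ h)/andP[? _]] := inv k; lra.
suff : 0 <= D 0%N by rewrite subr_ge0.
rewrite leNgt; apply/negP => Dneg.
(* If D_0 < 0, then |A_k h| stays above a fixed [e], which contradicts the telescoped bound on the
   sum of the |A_k h|^2. The summand 1 keeps the divisor positive. *)
pose L := (`|lam| + K) * N h + 1.
have L0 : 0 < L by rewrite ltr_wpDl// mulr_ge0 ?N_ge0// addr_ge0.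
pose e := - D 0%N / L.
have e0 : 0 < e by rewrite divr_gt0// oppr_gt0.
have low k : e <= N (B k h).
  rewrite /e ler_pdivrMr//.
  have h1 : - D k <= (`|lam| + K) * N h * N (B k h).
    have c1 := cauchy_schwarz (Y (B k h)) h.
    have c2 := cauchy_schwarz_norm (B k h) h.
    have c3 : N (Y (B k h)) * N h <= K * N (B k h) * N h by rewrite ler_wpM2r ?N_ge0.
    have c4 : - (lam * re (B k h) h) <= `|lam| * (N (B k h) * N h).
      apply: le_trans (ler_norm _) _; rewrite normrN normrM ler_wpM2l//.
    by rewrite /D; move: c1 c3 c4; lra.
  have h2 : - D 0%N <= - D k by rewrite lerN2.
  have h3 : (`|lam| + K) * N h * N (B k h) <= N (B k h) * L.
    by rewrite /L; have := N_ge0 (B k h); lra.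
  exact: le_trans h2 (le_trans h1 h3).
have bnd k : k%:R * e ^+ 2 <= re (A h) h.
  apply: le_trans (tele k); rewrite mulr_natl -[X in _ *+ X]card_ord -sumr_const.
  by apply: ler_sum => i _; rewrite -N_sqr ler_sqr ?nnegrE ?N_ge0// ltW.
have e20 : 0 < e ^+ 2 by exact: exprn_gt0.
have := bnd (Num.bound (re (A h) h / e ^+ 2)).
rewrite leNgt => /negP; apply.
have [/andP[Ah0 _]] := A01 h.
rewrite -ltr_pdivrMr//.
have := archi_boundP (divr_ge0 Ah0 (ltW e20)).
by [].
Qed.

(* The truncation inequality behind the entropy bound: [b] plays the role of
   [(t - lam)_+] and [Y] that of the low-frequency part of [T]. *)
Lemma truncation_bound T M (b : {poly R}) Y (lam : R) w :
  selfadjoint T -> 0 < M -> lip T M -> linear Y -> 0 <= lam -> lip Y lam ->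
  (forall f, Y (T f) = T (Y f)) ->
  (forall l, approx_eig T l -> exists2 r : R, l = r%:C & 0 <= b.[r] <= r) ->
  re (poly_op (('X - (2 * lam)%:P) * b) T w) w <= N (T w - Y w) ^+ 2.
Proof.
move=> sT M0 hM lY lam0 hY YT hb.
have lT := selfadjoint_linear sT.
have sb := poly_op_selfadjoint b sT.
have sbr := selfadjoint_re sb.
have lb := poly_op_linear b lT.
have pos (q : {poly R}) : (forall r : R, 0 <= b.[r] -> b.[r] <= r -> r <= M -> 0 <= q.[r]) ->
    forall f, 0 <= re (poly_op q T f) f.
  move=> hq f; apply: (poly_op_ge0 sT (ltW M0) hM) => l al.
  have [r rE /andP[h1 h2]] := hb _ al; exists r => //; apply: hq => //.
  by apply: (approx_eig_le hM); rewrite -rE.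
have b0 f : 0 <= re (poly_op b T f) f by apply: pos => r.
have bM f : re (poly_op b T f) f <= M * re f f.
  have := @pos (M%:P - b) _ f; rewrite poly_opB poly_opC reBl reZl subr_ge0; apply.
  by move=> r h1 h2 h3; rewrite !hornerE; lra.
(* The inequality b^2 <= t b lets |b(T) w|^2 be absorbed later by <T b(T) w, w>. *)
have bb : N (poly_op b T w) ^+ 2 <= re (poly_op ('X * b) T w) w.
  have hq (r : R) : 0 <= b.[r] -> b.[r] <= r -> r <= M -> 0 <= ('X * b - b * b).[r].
    by move=> h1 h2 h3; rewrite !hornerE -mulrBl mulr_ge0// subr_ge0.
  have := pos _ hq w; rewrite poly_opB reBl (poly_opM b b)// sbr -N_sqr.
  by rewrite subr_ge0.
(* Division by [M] puts the operator between 0 and 1, as the Riesz iteration requires; the factor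
   cancels afterwards. *)
pose A f := M^-1%:C *: poly_op b T f.
have Mi : 0 < M^-1 by rewrite invr_gt0.
have sA : selfadjoint A by move=> f g; rewrite innerZl innerZr conjc_real sb.
have YA f : Y (A f) = A (Y f) by rewrite /A (linZ lY) (poly_op_comm _ _ lY).
have A01 f : 0 <= re (A f) f <= re f f.
  rewrite reZl mulr_ge0 ?(ltW Mi)//= mulrC ler_pdivrMr// [_ * M]mulrC; exact: bM.
have Yl f : re (Y f) f <= lam * re f f.
  apply: le_trans (cauchy_schwarz _ _) _.
  by rewrite -N_sqr expr2 mulrA ler_wpM2r ?N_ge0.
have := commuting_product_le w sA lY lam0 hY YA A01 Yl.
rewrite /A (linZ lY) !reZl mulrCA ler_pM2l// => hBw.
have E1 : re (poly_op ('X * b) T w) w = re (Y (poly_op b T w)) w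
    + re (poly_op b T w) (T w - Y w).
  have -> : re (Y (poly_op b T w)) w = re (poly_op b T w) (Y w).
    by rewrite (poly_op_comm _ _ lY YT) sbr reC.
  by rewrite poly_opM// poly_opX (selfadjoint_re sT) reBr addrC subrK.
have cs := cauchy_schwarz (poly_op b T w) (T w - Y w).
(* Through [bb], half of <T b(T) w, w> is absorbed on the left; clearing that half turns [lam] into
   2 lam. *)
have h2 : 2 * (N (poly_op b T w) * N (T w - Y w)) <=
    N (poly_op b T w) ^+ 2 + N (T w - Y w) ^+ 2.
  by have := sqr_ge0 (N (poly_op b T w) - N (T w - Y w)); lra.
rewrite mulrBl poly_opB reBl mul_polyC poly_opZ reZl.
by move: E1 bb h2 cs hBw; lra.
Qed.

End polynomial_calculus.

(** * The scalar inequality *)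

Section scalar_inequality.
Variable R : realType.
Implicit Types t L M c lam : R.

(* On [0, M] the polynomial [b] lies between [9/16 B] and [B], where
   [B t = t^3 / (t + lam)^2]; the factor [1 / (t + lam)] is a truncated geometric
   series in [(M - t) / (M + lam)]. *)
Lemma cutoff_poly M lam : 0 < M -> 0 < lam -> exists b : {poly R},
  forall t, 0 < t -> t <= M -> [/\ 0 <= b.[t] <= t,
    t ^+ 2 / 2 - 4 * lam * t <= (t - 2 * lam) * b.[t] &
    - (2 * t ^+ 3 / lam) <= (t - 2 * lam) * b.[t]].
Proof.
move=> M0 l0.
have Ml0 : 0 < M + lam by rewrite addr_gt0.
pose q0 := M / (M + lam).
have q00 : 0 <= q0 by rewrite divr_ge0 ?ltW.
have q01 : q0 < 1 by rewrite ltr_pdivrMr// mul1r ltrDl.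
(* A series remainder of at most 1/4 places [rho] in [3/4, 1], hence its square in [9/16, 1]. *)
have [K hK] : exists K : nat, q0 ^+ K <= 4^-1.
  have : (fun n => q0 ^+ n) @ \oo --> (0 : R) by apply: cvg_expr; rewrite ger0_norm.
  move=> /cvgrPdist_le /(_ 4^-1) [|K _ h]; first by rewrite invr_gt0.
  exists K; have := h K (leqnn K); rewrite sub0r normrN ger0_norm// exprn_ge0//.
pose q : {poly R} := (M + lam)^-1 *: (M%:P - 'X).
pose r : {poly R} := (M + lam)^-1 *: \sum_(i < K) q ^+ i.
exists ('X * ('X * r) ^+ 2) => t t0 tM.
pose Q := (M - t) / (M + lam).
have qE : q.[t] = Q by rewrite /q !hornerE mulrC.
have Q0 : 0 <= Q by rewrite divr_ge0 ?subr_ge0 ?(ltW Ml0).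
have Qq : Q <= q0 by rewrite /Q /q0 ler_pM2r ?invr_gt0// gerBl ltW.
pose rho := (t + lam) * r.[t].
have rhoE : rho = 1 - Q ^+ K.
  rewrite /rho /r hornerZ horner_sum.
  under eq_bigr do rewrite horner_exp qE.
  have -> : 1 - Q ^+ K = (1 - Q) * \sum_(i < K) Q ^+ i.
    by rewrite -[1 in LHS](expr1n _ K) subrXX; congr (_ * _);
      apply: eq_bigr => i _; rewrite expr1n mul1r.
  by rewrite mulrA; congr (_ * _); rewrite /Q; field; rewrite gt_eqF.
have QK : 0 <= Q ^+ K <= 4^-1.
  rewrite exprn_ge0//=; apply: le_trans hK; exact: lerXn2r.
have rho1 : rho <= 1 by rewrite rhoE; move: QK => /andP[? ?]; lra.
have rho3 : 3 / 4 <= rho by rewrite rhoE; move: QK => /andP[? ?]; lra.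
have tl0 : 0 < t + lam by rewrite addr_gt0.
pose B := t ^+ 3 / (t + lam) ^+ 2.
have B0 : 0 <= B by rewrite divr_ge0 ?exprn_ge0 ?ltW.
have Bt : B <= t.
  rewrite ler_pdivrMr ?exprn_gt0// exprS ler_pM2l// ler_sqr ?nnegrE ?ltW//.
  by rewrite ltrDl.
have Bl : B <= t ^+ 3 / lam ^+ 2.
  rewrite ler_pM2l ?exprn_gt0// lef_pV2 ?posrE ?exprn_gt0//.
  by rewrite ler_sqr ?nnegrE ?ltW// ltrDr.
have bE : ('X * ('X * r) ^+ 2).[t] = B * rho ^+ 2.
  by rewrite hornerM horner_exp hornerM hornerX /B /rho; field; rewrite gt_eqF.
have rr : 9 / 16 <= rho ^+ 2 <= 1.
  apply/andP; split.
    have -> : 9 / 16 = (3 / 4) ^+ 2 :> R by field.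
    by rewrite ler_sqr ?nnegrE//; lra.
  by rewrite expr_le1//; lra.
have claim1 : t ^+ 2 - 4 * lam * t <= (t - 2 * lam) * B.
  rewrite /B mulrA ler_pdivlMr ?exprn_gt0//.
  rewrite -subr_ge0.
  have -> : (t - 2 * lam) * t ^+ 3 - (t ^+ 2 - 4 * lam * t) * (t + lam) ^+ 2 =
    7 * (lam ^+ 2 * t ^+ 2) + 4 * (lam ^+ 3 * t) by ring.
  by rewrite addr_ge0// mulr_ge0// mulr_ge0// ?exprn_ge0// ltW.
rewrite bE; set p := rho ^+ 2 in rr *.
move: rr => /andP[p9 p1].
have Bp0 : 0 <= B * p by rewrite mulr_ge0//; lra.
have BpB : B * p <= B by rewrite ler_piMr.
have lt0 : 0 < lam * t by rewrite mulr_gt0.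
have t20 : 0 < t ^+ 2 by rewrite exprn_gt0.
split.
- by rewrite Bp0/=; exact: le_trans Bt.
(* Where t - 2 lam <= 0 the useful bound is b <= B, elsewhere it is b >= 9/16 B. The factor 9/16 is
   why only t^2 / 2 is claimed. *)
- have [h|h] := leP (t - 2 * lam) 0.
    have : (t - 2 * lam) * B <= (t - 2 * lam) * (B * p) by apply: ler_wnM2l.
    by move: claim1; lra.
  have h2 : (t - 2 * lam) * B * (9 / 16) <= (t - 2 * lam) * B * p.
    by apply: ler_wpM2l => //; rewrite mulr_ge0// ltW.
  have e1 : t ^+ 2 / 2 - 4 * lam * t <= (t ^+ 2 - 4 * lam * t) * (9 / 16) by lra.
  have e2 : (t ^+ 2 - 4 * lam * t) * (9 / 16) <= (t - 2 * lam) * B * (9 / 16).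
    by rewrite ler_pM2r//; lra.
  by rewrite mulrA; exact: le_trans e1 (le_trans e2 h2).
- have h1 : lam * (B * p) <= t ^+ 3 / lam.
    have -> : t ^+ 3 / lam = lam * (t ^+ 3 / lam ^+ 2) by field; rewrite gt_eqF.
    by rewrite ler_pM2l//; exact: le_trans Bl.
  have h2 : 0 <= t * (B * p) by rewrite mulr_ge0// ltW.
  by move: h1 h2; rewrite -!mulrA; lra.
Qed.

Lemma sum_geom_up L m : 2 <= L -> \sum_(0 <= j < m) L ^+ j.+1 <= 2 * L ^+ m.
Proof.
move=> L2; elim: m => [|m IH]; first by rewrite big_nil mulr_ge0// exprn_ge0// (le_trans _ L2).
rewrite big_nat_recr//=; apply: le_trans (lerD IH (lexx _)) _.
have : 0 <= (L - 2) * L ^+ m by rewrite mulr_ge0 ?subr_ge0// exprn_ge0// (le_trans _ L2).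
by rewrite exprS; lra.
Qed.

Lemma sum_geom_down (q : R) d : 0 <= q -> q <= 2^-1 -> \sum_(0 <= i < d) q ^+ i <= 2.
Proof.
move=> q0 q2; suff : \sum_(0 <= i < d) q ^+ i <= 2 - 2 * q ^+ d.
  by have := exprn_ge0 d q0; lra.
elim: d => [|d IH]; first by rewrite big_nil expr0; lra.
rewrite big_nat_recr//=; apply: le_trans (lerD IH (lexx _)) _.
have : 0 <= (2^-1 - q) * q ^+ d by rewrite mulr_ge0 ?subr_ge0// exprn_ge0.
by rewrite exprS; lra.
Qed.

(** Let m be the first index with t <= L^(m+1). The levels below m contribute at least (m/2 - 8) t^2
    and the others at least -4 t^2, while t^2 ln(t^2) <= 2 (m+1) ln L t^2. The factor 4 ln L turns
    (m/2 - 12) t^2 into (2m - 48) ln L t^2, so 50 ln L t^2 makes up the difference. *)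
Lemma entropy_le_cutoffs L t (F : nat -> R) J : 2 <= L -> 0 < t -> t <= L ^+ J ->
  (forall j, t ^+ 2 / 2 - 4 * L ^+ j.+1 * t <= F j) ->
  (forall j, - (2 * t ^+ 3 / L ^+ j.+1) <= F j) ->
  t ^+ 2 * ln (t ^+ 2) <= 50 * ln L * t ^+ 2 + 4 * ln L * \sum_(0 <= j < J) F j.
Proof.
move=> L2 t0 tJ F1 F2.
have L0 : 0 < L by apply: lt_le_trans L2.
have ex : exists m, t <= L ^+ m.+1.
  by exists J; apply: le_trans tJ _; rewrite ler_weXn2l//; lra.
case: (ex_minnP ex) => m tm mmin.
have mJ : (m <= J)%N.
  by apply: mmin; apply: le_trans tJ _; rewrite ler_weXn2l//; lra.
have lnL : 0 <= ln L by rewrite ln_ge0//; lra.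
have lnt : ln (t ^+ 2) <= 2 * ((m.+1)%:R * ln L).
  rewrite lnXn// mulr_natl; rewrite ler_pMn2r//.
  have -> : m.+1%:R * ln L = ln (L ^+ m.+1) by rewrite lnXn// mulr_natl.
  by rewrite ler_ln ?posrE ?exprn_gt0.
have S1 : (m%:R / 2 - 8) * t ^+ 2 <= \sum_(0 <= j < m) F j.
  have : \sum_(0 <= j < m) (t ^+ 2 / 2 - 4 * L ^+ j.+1 * t) <= \sum_(0 <= j < m) F j.
    by apply: ler_sum => j _; exact: F1.
  rewrite sumrB sumr_const_nat subn0 -mulr_suml -mulr_sumr.
  have g := sum_geom_up m L2.
  have g2 : \sum_(0 <= j < m) L ^+ j.+1 <= 2 * t.
    (* For m = 0 the sum is empty; otherwise minimality of m gives L^m <= t. *)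
    case: m g mmin {tm mJ lnt ex} => [|m] g mmin; first by rewrite big_nil mulr_ge0// ltW.
    apply: le_trans g _; rewrite ler_pM2l//.
    by rewrite leNgt; apply/negP => h; have := mmin m (ltW h); rewrite ltnn.
  have : (\sum_(0 <= j < m) L ^+ j.+1) * t <= 2 * t * t by rewrite ler_pM2r.
  rewrite -mulr_natl expr2; lra.
have S2 : - 4 * t ^+ 2 <= \sum_(m <= j < J) F j.
  have : \sum_(m <= j < J) - (2 * t ^+ 3 / L ^+ j.+1) <= \sum_(m <= j < J) F j.
    by apply: ler_sum => j _; exact: F2.
  apply: le_trans; rewrite -{1}[m]add0n big_addn sumrN -mulr_sumr mulNr lerN2.
  have -> : \sum_(0 <= i < J - m) (L ^+ (i + m).+1)^-1 =
      (L ^+ m.+1)^-1 * \sum_(0 <= i < J - m) L^-1 ^+ i.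
    rewrite mulr_sumr; apply: eq_bigr => i _.
    by rewrite -addnS exprD invfM mulrC exprVn.
  have Li : 0 <= L^-1 by rewrite invr_ge0 ltW.
  have Li2 : L^-1 <= 2^-1 by rewrite lef_pV2 ?posrE.
  have g := sum_geom_down (J - m) Li Li2.
  have h : t / L ^+ m.+1 <= 1 by rewrite ler_pdivrMr ?exprn_gt0// mul1r.
  have -> : 2 * t ^+ 3 * ((L ^+ m.+1)^-1 * \sum_(0 <= i < J - m) L^-1 ^+ i) =
    2 * t ^+ 2 * ((t / L ^+ m.+1) * \sum_(0 <= i < J - m) L^-1 ^+ i) by ring.
  have t20 : 0 < t ^+ 2 by rewrite exprn_gt0.
  have s0 : 0 <= \sum_(0 <= i < J - m) L^-1 ^+ i by apply: sumr_ge0 => i _; rewrite exprn_ge0.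
  have h2 : (t / L ^+ m.+1) * \sum_(0 <= i < J - m) L^-1 ^+ i <= 2.
    apply: le_trans g; apply: ler_piMl => //.
  have -> : 4 * t ^+ 2 = 2 * t ^+ 2 * 2 by ring.
  by rewrite ler_pM2l// mulr_gt0.
have SS : \sum_(0 <= j < J) F j = \sum_(0 <= j < m) F j + \sum_(m <= j < J) F j.
  by rewrite (big_cat_nat (n := m)).
rewrite SS; set s1 := \sum_(0 <= j < m) F j in S1 *; set s2 := \sum_(m <= j < J) F j in S2 *.
have t20 : 0 < t ^+ 2 by rewrite exprn_gt0.
have k1 : t ^+ 2 * ln (t ^+ 2) <= t ^+ 2 * (2 * ((m.+1)%:R * ln L)) by rewrite ler_pM2l.
have k2 : ln L * ((m%:R / 2 - 12) * t ^+ 2) <= ln L * (s1 + s2).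
  by apply: ler_wpM2l => //; lra.
rewrite -natr1 in k1.
by move: k1 k2; lra.
Qed.

(** Rescaling t by [c] reduces to the levels L^(j+1). Only [J] and the polynomials depend on [M] and
    [c], the two coefficients do not; this keeps the final constant independent of [x]. *)
Lemma entropy_poly_bound L M c : 2 <= L -> 0 < M -> 0 < c ->
  exists J (b : nat -> {poly R}), forall t, 0 < t -> t <= M ->
    (forall j, 0 <= (b j).[t] <= t) /\
    t ^+ 2 * ln (t ^+ 2 / c ^+ 2) <= 50 * ln L * t ^+ 2 +
      4 * ln L * \sum_(0 <= j < J) (t - 2 * (L ^+ j.+1 * c)) * (b j).[t].
Proof.
move=> L2 M0 c0.
have L0 : 0 < L by apply: lt_le_trans L2.
have Mc : 0 < M / c by rewrite divr_gt0.
have [J hJ] : exists J : nat, M / c <= L ^+ J.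
  exists (Num.bound (M / c)); apply: le_trans (ltW (archi_boundP (ltW Mc))) _.
  elim: (Num.bound _) => [|k IH]; first by rewrite expr0 ler01.
  have h : 1 <= L ^+ k by rewrite exprn_ege1//; lra.
  rewrite -natr1 exprS; have : 0 <= (L - 2) * L ^+ k by rewrite mulr_ge0//; lra.
  by lra.
pose b0 j := sval (cid (@cutoff_poly (M / c) (L ^+ j.+1) Mc (exprn_gt0 _ L0))).
exists J, (fun j => c *: (b0 j \Po (c^-1 *: 'X))) => t t0 tM.
pose u := t / c.
have u0 : 0 < u by rewrite divr_gt0.
have uM : u <= M / c by rewrite ler_pM2r ?invr_gt0.
have tE : t = c * u by rewrite /u mulrC divfK// gt_eqF.
have bE j : (c *: (b0 j \Po (c^-1 *: 'X))).[t] = c * (b0 j).[u].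
  by rewrite hornerZ horner_comp hornerZ hornerX mulrC /u [c^-1 * _]mulrC mulrC.
have hb j : [/\ 0 <= (b0 j).[u] <= u,
    u ^+ 2 / 2 - 4 * L ^+ j.+1 * u <= (u - 2 * L ^+ j.+1) * (b0 j).[u] &
    - (2 * u ^+ 3 / L ^+ j.+1) <= (u - 2 * L ^+ j.+1) * (b0 j).[u]].
  by rewrite /b0; case: cid => b /= /(_ _ u0 uM).
split=> [j|].
  rewrite bE; have [/andP[h1 h2] _ _] := hb j.
  by rewrite mulr_ge0 ?(ltW c0)//= tE ler_pM2l.
have := @entropy_le_cutoffs L u (fun j => (u - 2 * L ^+ j.+1) * (b0 j).[u]) J L2 u0
  (le_trans uM hJ) (fun j => let: And3 _ h _ := hb j in h)
  (fun j => let: And3 _ _ h := hb j in h).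
have -> : t ^+ 2 / c ^+ 2 = u ^+ 2 by rewrite /u expr_div_n.
rewrite tE => h.
have -> : \sum_(0 <= j < J) (c * u - 2 * (L ^+ j.+1 * c)) *
    (c *: (b0 j \Po (c^-1 *: 'X))).[c * u]
   = c ^+ 2 * \sum_(0 <= j < J) (u - 2 * L ^+ j.+1) * (b0 j).[u].
  rewrite mulr_sumr; apply: eq_bigr => j _; rewrite -tE bE tE; ring.
have c2 : 0 < c ^+ 2 by rewrite exprn_gt0.
move: h; rewrite -(ler_pM2l c2) => h.
apply: le_trans (le_trans _ h) _; rewrite le_eqVlt; apply/orP; left; apply/eqP.
  by ring.
by ring.
Qed.

End scalar_inequality.

(** * The commutant of the noncommutative torus *)

Section torus_operators.
Variables (R : realType) (n : nat) (theta : 'M[R]_n).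
Hypothesis skew : theta^T = - theta.
Local Notation C := R[i].
Local Notation H := (L2 R n).
Local Notation N := (@L2norm R n).
Local Notation mu := (torus_measure R n).
Local Notation one := (L2one R n).
Implicit Types (f g h : H) (S T x : H -> H) (k l : 'rV[int]_n).

Lemma bounded_op_of_lip T (M : R) : 0 <= M -> linear T -> lip T M -> bounded_op T.
Proof.
move=> M0 lT hM; split => //; apply: (@le_lt_trans _ _ M%:E); last exact: ltry.
apply: ub_ereal_sup => _ [f /= f1 <-]; rewrite lee_fin.
by apply: le_trans (hM f) _; rewrite ler_piMr.
Qed.

Lemma adjoint_eq T S : bounded_op S -> (forall f g, inner (T f) g = inner f (S g)) ->
  adjoint T = S.
Proof.
move=> bS TS; rewrite /adjoint; apply: xget_unique; first by split.
move=> S' [_ TS']; apply/funext => g; apply: inner_separate => h.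
by rewrite innerC -TS' TS -innerC.
Qed.

Definition unimodular (c : C) := c * c^*%C = 1.

Lemma unimodularM c d : unimodular c -> unimodular d -> unimodular (c * d).
Proof. by rewrite /unimodular => hc hd; rewrite conjcM mulrACA hc hd mulr1. Qed.

Lemma unimodularJ c : unimodular c -> unimodular c^*%C.
Proof. by rewrite /unimodular conjcK mulrC. Qed.

Lemma unimodular_expi a : unimodular (expi a).
Proof. exact: expi_conj. Qed.

Lemma unimodular1 : unimodular 1.
Proof. by rewrite /unimodular conjc1 mulr1. Qed.

Section one_weyl.
Variables (c : C) (k : 'rV[int]_n) (v : 'I_n -> R).
Hypothesis c1 : unimodular c.

Lemma weyl_isometry f g : inner (weyl c k v f) (weyl c k v g) = inner f g.
Proof. by rewrite inner_weyl c1 mul1r. Qed.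

Lemma N_weyl f : N (weyl c k v f) = N f.
Proof. by rewrite /L2norm weyl_isometry. Qed.

Lemma weyl_inv f :
  weyl c k v (weyl (c^*%C * expi (dot k v)) (- k) (fun j => - v j) f) = f.
Proof.
rewrite weyl_comp subrr dotNl expiN mulrA c1 mul1r expi_conj -[RHS]weyl1.
by congr weyl; apply/funext => j; rewrite subrr.
Qed.

Lemma adjoint_weyl :
  adjoint (weyl c k v) = weyl (c^*%C * expi (dot k v)) (- k) (fun j => - v j).
Proof.
apply: adjoint_eq.
  apply: (@bounded_op_of_lip _ 1) => //; first exact: weyl_linear.
  by move=> f; rewrite mul1r -{2}[f]weyl_inv N_weyl.
by move=> f g; rewrite -{1}[g]weyl_inv weyl_isometry.
Qed.

End one_weyl.

(** The vector pi theta k, which is the translation that U^k performs. *)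
Definition weyl_vec k (l : 'I_n) : R := pi * \sum_(j < n) theta l j * (k 0 j)%:~R.

Lemma weyl_vecD k l j : weyl_vec (k + l) j = weyl_vec k j + weyl_vec l j.
Proof.
rewrite /weyl_vec -mulrDr -big_split; congr (_ * _); apply: eq_bigr => i _.
by rewrite mxE intrD mulrDr.
Qed.

Lemma weyl_vecN k j : weyl_vec (- k) j = - weyl_vec k j.
Proof.
rewrite /weyl_vec -mulrN -sumrN; congr (_ * _); apply: eq_bigr => i _.
by rewrite mxE intrN mulrN.
Qed.

Lemma weyl_vec0 : weyl_vec 0 = (fun=> 0).
Proof.
by apply/funext => j; rewrite /weyl_vec big1 ?mulr0// => i _; rewrite mxE mulr0.
Qed.

(** Skew-symmetry of theta in the form used to match the exchange phases in [weyl_commute] and to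
    kill the phase of the adjoint of U^k. *)
Lemma dot_weyl_vec k l : dot l (weyl_vec k) = - dot k (weyl_vec l).
Proof.
rewrite /dot /weyl_vec.
under eq_bigr do rewrite mulrCA mulr_sumr.
under [in RHS]eq_bigr do rewrite mulrCA mulr_sumr.
rewrite -!mulr_sumr -mulrN; congr (_ * _); rewrite exchange_big -sumrN /=.
apply: eq_bigr => j _; rewrite -sumrN; apply: eq_bigr => i _.
have -> : theta i j = - theta j i.
  by have := congr1 (fun A : 'M[R]_n => A j i) skew; rewrite !mxE.
ring.
Qed.

Lemma dot_weyl_vec_diag k : dot k (weyl_vec k) = 0.
Proof. by have := dot_weyl_vec k k; lra. Qed.

(** The phase stays unspecified: only its modulus matters, so the ordering phase of U_1^(k_1) ...
    U_n^(k_n) is never computed. *)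
Definition weyl_at k T := exists2 c, unimodular c & T = weyl c k (weyl_vec k).

Lemma weyl_at_comp k l S T : weyl_at k S -> weyl_at l T -> weyl_at (k + l) (S \o T).
Proof.
move=> [c hc ->] [d hd ->]; exists (c * d * expi (dot l (weyl_vec k))).
  by do !apply: unimodularM => //; exact: unimodular_expi.
apply/funext => f /=; rewrite weyl_comp; congr weyl.
by apply/funext => j; rewrite weyl_vecD.
Qed.

Lemma weyl_at_id : weyl_at 0 id.
Proof.
by exists 1; [exact: unimodular1|apply/funext => f; rewrite weyl_vec0 weyl1].
Qed.

Lemma weyl_at_iter k T p : weyl_at k T -> weyl_at (k *+ p) (iter p T).
Proof.
move=> hT; elim: p => [|p IH]; first exact: weyl_at_id.
by rewrite mulrS; exact: (weyl_at_comp hT IH).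
Qed.

Lemma weyl_at_adjoint k T : weyl_at k T -> weyl_at (- k) (adjoint T).
Proof.
move=> [c hc ->]; exists (c^*%C * expi (dot k (weyl_vec k))).
  by apply: unimodularM; [exact: unimodularJ|exact: unimodular_expi].
rewrite adjoint_weyl//; congr weyl; apply/funext => j; by rewrite weyl_vecN.
Qed.

Lemma weyl_at_U j : weyl_at (delta_mx 0 j) (U theta j).
Proof.
exists 1; first exact: unimodular1.
apply/funext => f; rewrite /U /weyl; congr (\pi_H%qT _).
have vE : weyl_vec (delta_mx 0 j) = (fun i : 'I_n => pi * theta i j).
  apply/funext => l; rewrite /weyl_vec (bigD1 j)//= mxE !eqxx mulr1 big1 ?addr0//.
  by move=> i /negbTE ij; rewrite mxE eqxx ij mulr0.
have E : (fun t => (cos (tnth t j) +i* sin (tnth t j)) *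
    repr f (translate (fun i : 'I_n => pi * theta i j) t)) =
    wfun 1 (delta_mx 0 j) (weyl_vec (delta_mx 0 j)) (repr f).
  apply/funext => t; rewrite /wfun vE mul1r; congr (expi _ * _).
  rewrite /dot (bigD1 j)//= mxE !eqxx mul1r big1 ?addr0//.
  by move=> i /negbTE ij; rewrite mxE eqxx ij mul0r.
apply: val_inj; rewrite /U_fun E insubdK//; exact: wfun_sq_integrable.
Qed.

Lemma row_int_sum k : k = \sum_j delta_mx 0 j *~ k 0 j.
Proof.
apply/rowP => j; rewrite summxE (bigD1 j)//= big1 ?addr0; last first.
  by move=> i /negbTE ij; rewrite -scaler_int mxE mxE eq_sym ij mulr0.
by rewrite -scaler_int mxE mxE !eqxx mulr1 intz.
Qed.

Lemma weyl_at_Upow k : weyl_at k (Upow theta k).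
Proof.
rewrite {1}[k]row_int_sum /Upow.
elim/big_rec2 : _ => [|j S l _ IH]; first exact: weyl_at_id.
apply: weyl_at_comp IH.
have hU := weyl_at_U j.
case: (k 0 j) => p /=; first exact: weyl_at_iter.
by rewrite NegzE mulrNz -mulNrn; apply: (@weyl_at_iter _ _ p.+1); exact: weyl_at_adjoint.
Qed.

Lemma inner_one : inner one one = 1.
Proof.
rewrite inner_pi /fun_inner (_ : (fun t => _) = cst 1); last first.
  by apply/funext => t; rewrite -[LHS]/(1 * 1^*%C) conjc1 mulr1.
rewrite /complex_integral /Rintegral /= !integral_cst//= probability_setT !mule1.
by [].
Qed.

(** A translation by w with m.w = pi is unitary, fixes [1] and negates the character of frequency m;
    the inner product thus equals its opposite, and no integral is computed. *)
Lemma weyl_one_orthogonal c m v : m != 0 -> inner (weyl c m v one) one = 0.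
Proof.
move=> m0; have [j mj] : exists j, m 0 j != 0.
  apply/existsP; apply: contraNT m0; rewrite negb_exists => /forallP h.
  by apply/eqP/rowP => j; rewrite mxE; apply/eqP; have := h j; rewrite negbK.
rewrite weyl_one_shift weyl_scale innerZl; apply/eqP; rewrite mulf_eq0; apply/orP; right.
pose w (l : 'I_n) : R := if l == j then pi / (m 0 j)%:~R else 0.
have hw : dot m w = pi.
  rewrite /dot (bigD1 j)//= /w eqxx big1 ?addr0; last first.
    by move=> i /negbTE ->; rewrite mulr0.
  by rewrite mulrC divfK// intr_eq0.
set e := weyl 1 m _ one.
have := @weyl_isometry 1 0 w unimodular1 e one.
have -> : weyl 1 0 w one = one by rewrite weyl_one_shift weyl1.
have -> : weyl 1 0 w e = - e.
  rewrite /e weyl_comp hw !mul1r add0r weyl_one_shift weyl_scale.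
  rewrite /expi cospi sinpi -[RHS]scaleN1r; congr (_ *: _).
  by apply/eqP; rewrite eq_complex /= oppr0 !eqxx.
rewrite -scaleN1r innerZl mulN1r => /eqP; rewrite eq_sym -addr_eq0 -mulr2n mulrn_eq0.
by [].
Qed.

Definition freq_vec k : H := Upow theta k one.

Definition Upow_phase k : C := sval (cid2 (weyl_at_Upow k)).

Lemma Upow_phase_unimodular k : unimodular (Upow_phase k).
Proof. by rewrite /Upow_phase; case: cid2. Qed.

Lemma UpowE k : Upow theta k = weyl (Upow_phase k) k (weyl_vec k).
Proof. by rewrite /Upow_phase; case: cid2. Qed.

(* [V_k] lies in the commutant of the algebra generated by the [U_j], and
   [V_k 1 = U^k 1]. *)
Definition commutant_weyl k : H -> H :=
  weyl (Upow_phase k) k (fun j => - weyl_vec k j).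

Lemma commutant_one k : commutant_weyl k one = freq_vec k.
Proof.
by rewrite /commutant_weyl /freq_vec UpowE weyl_one_shift [RHS]weyl_one_shift.
Qed.

Lemma N_commutant k f : N (commutant_weyl k f) = N f.
Proof. exact: N_weyl (Upow_phase_unimodular k) f. Qed.

(** With opposite shifts the two orders produce the phases e^(-i l.(pi theta k)) and e^(i k.(pi
    theta l)), which agree by skew-symmetry. *)
Lemma weyl_commute c d k l f :
  weyl c k (fun j => - weyl_vec k j) (weyl d l (weyl_vec l) f) =
  weyl d l (weyl_vec l) (weyl c k (fun j => - weyl_vec k j) f).
Proof.
rewrite !weyl_comp dotNr dot_weyl_vec opprK [d * c]mulrC addrC.
by congr weyl; apply/funext => j; rewrite addrC.
Qed.

Lemma Upow_linear k : linear (Upow theta k).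
Proof. by rewrite UpowE; exact: weyl_linear. Qed.

Lemma N_Upow k f : N (Upow theta k f) = N f.
Proof. by rewrite UpowE N_weyl//; exact: Upow_phase_unimodular. Qed.

(** Moving the unitary U^l to the other side leaves a Weyl operator of frequency k - l at [1]. *)
Lemma freq_vec_orthonormal k l : inner (freq_vec k) (freq_vec l) = (k == l)%:R.
Proof.
have [<-|kl] := eqVneq k l.
  by rewrite /freq_vec UpowE weyl_isometry ?inner_one//; exact: Upow_phase_unimodular.
rewrite /freq_vec !UpowE.
have hd := Upow_phase_unimodular l; set d := Upow_phase l in hd *.
rewrite -[weyl _ k _ one](weyl_inv l (weyl_vec l) hd) weyl_isometry// weyl_comp.
by rewrite weyl_one_orthogonal// addrC subr_eq0.
Qed.

Lemma inner_suml (I : Type) (r : seq I) (F : I -> H) g :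
  inner (\sum_(i <- r) F i) g = \sum_(i <- r) inner (F i) g.
Proof. by elim/big_rec2 : _ => [|i u v _ <-]; [exact: inner0l|exact: innerDl]. Qed.

Lemma inner_freq_sum (F : {fset 'rV[int]_n}) (u : 'rV[int]_n -> C) k :
  inner (\sum_(l <- F) u l *: freq_vec l) (freq_vec k) = if k \in F then u k else 0.
Proof.
rewrite inner_suml.
under eq_bigr do rewrite innerZl freq_vec_orthonormal.
case: ifPn => kF.
  rewrite (big_fsetD1 k)//= eqxx mulr1 big1_seq ?addr0// => l /=.
  by rewrite !inE => /andP[/negbTE ->]; rewrite mulr0.
rewrite big1_seq// => l /= lF; case: eqVneq => [lk|_]; last by rewrite mulr0.
by rewrite -lk lF in kF.
Qed.

Lemma N_freq_sum (F : {fset 'rV[int]_n}) (u : 'rV[int]_n -> C) :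
  N (\sum_(l <- F) u l *: freq_vec l) ^+ 2 = \sum_(l <- F) sqmod (u l).
Proof.
rewrite N_sqr /re; set S := \sum_(l <- F) _.
suff -> : inner S S = (\sum_(l <- F) sqmod (u l))%:C by [].
rewrite {1}/S inner_suml rmorph_sum; apply: eq_big_seq => l lF /=.
rewrite innerZl innerC inner_freq_sum lF.
by case: (u l) => a b; rewrite /sqmod; simpc; congr (_ +i* _); ring.
Qed.

End torus_operators.

(** * Frequency boxes *)

Section boxes.
Variables (R : realType) (n : nat).
Implicit Types (k : 'rV[int]_n) (F G : {fset 'rV[int]_n}).

Lemma fset_sum_split (V : nmodType) F G (g : 'rV[int]_n -> V) :
  \sum_(k <- F) g k = \sum_(k <- (F `&` G)%fset) g k + \sum_(k <- (F `\` G)%fset) g k.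
Proof.
rewrite (bigID (fun k => k \in G)) /=; congr (_ + _); rewrite -big_filter;
  apply: perm_big; apply: uniq_perm; rewrite ?filter_uniq ?fset_uniq// => k;
  by rewrite mem_filter !inE andbC.
Qed.

Lemma fset_sum_subset F G (g : 'rV[int]_n -> R) : (F `<=` G)%fset ->
  (forall k, 0 <= g k) -> \sum_(k <- F) g k <= \sum_(k <- G) g k.
Proof.
move=> FG g0; rewrite [leRHS](fset_sum_split G F) (fsetIidPr FG) lerDl.
by apply: sumr_ge0.
Qed.

(** Coordinates run from -P to P - 1. The even side keeps the count at (2P)^n, a power of 2 when P =
    2^Q, and every k with all |k_j| < P is reached. *)
Definition box_point P (f : {ffun 'I_n -> 'I_(P.*2)}) : 'rV[int]_n :=
  \row_j ((f j : nat)%:Z - P%:Z).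

Definition box P : {fset 'rV[int]_n} :=
  [fset k in [seq box_point f | f : {ffun 'I_n -> 'I_(P.*2)}]]%fset.

Lemma card_box P : (#|` box P| <= P.*2 ^ n)%N.
Proof.
rewrite card_fseq; apply: leq_trans (size_undup _) _.
by rewrite size_map -cardE card_ffun !card_ord.
Qed.

Lemma mem_box (P : nat) k : (forall j, (`|k 0%R j| < P)%N) -> k \in box P.
Proof.
move=> hk; rewrite !inE; apply/mapP.
have hj j : (`|(k 0 j + P%:Z)%R|%N < P.*2)%N by have := hk j; lia.
exists [ffun j => Ordinal (hj j)]; first by rewrite mem_enum.
apply/rowP => j; rewrite !mxE ffunE /=.
have := hk j; lia.
Qed.

Lemma freq_sqnorm_ge0 k : 0 <= freq_sqnorm R k.
Proof. by apply: sumr_ge0 => j _; rewrite sqr_ge0. Qed.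

Lemma freq_sqnorm_out_box P k : k \notin box P -> P%:R ^+ 2 <= freq_sqnorm R k.
Proof.
move=> kP; have [j hj] : exists j, (P <= `|k 0%R j|)%N.
  apply/existsP; apply: contraNT kP; rewrite negb_exists => /forallP h.
  by apply: mem_box => j; rewrite ltnNge.
rewrite /freq_sqnorm (bigD1 j)//= -[leLHS]addr0; apply: lerD; last first.
  by apply: sumr_ge0 => i _; rewrite sqr_ge0.
rewrite -[leRHS]real_normK ?num_real// ler_sqr ?nnegrE// -intr_norm.
by rewrite -[P%:R]/(P%:Z%:~R) ler_int; lia.
Qed.

Lemma box_cover F : exists Q, (F `<=` box (2 ^ Q))%fset.
Proof.
exists (\max_(k <- F) \max_(j < n) `|k 0%R j|)%N; apply/fsubsetP => k kF.
apply: mem_box => j; apply: leq_ltn_trans (ltn_expl _ _) => //.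
apply: (@leq_trans (\max_(j < n) `|k 0%R j|)%N).
  exact: (@leq_bigmax _ (fun j : 'I_n => `|k 0%R j|%N) j).
by rewrite (big_fsetD1 k)//= leq_maxl.
Qed.

Lemma card_boxR Q : #|` box (2 ^ Q)|%:R <= (2 ^+ n) ^+ Q.+1 :> R.
Proof.
apply: (@le_trans _ _ ((2 ^ Q).*2 ^ n)%:R); first by rewrite ler_nat card_box.
by rewrite -mul2n -expnS !natrX -!exprM mulnC.
Qed.

Lemma fset_sum_const F (c : R) : \sum_(k <- F) c = #|` F|%:R * c.
Proof. by rewrite big_const_seq count_predT iter_addr_0 mulr_natl. Qed.

(** Dyadic shells: the one between the boxes 2^Q and 2^(Q+1) has at most 2^(n(Q+2)) points of weight
    at most 4^(-nQ), hence adds at most 4^n 2^(-Q). This serves to show that the Sobolev sum of a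
    smooth element is finite. *)
Lemma weight_summable : (0 < n)%N ->
  exists K : R, forall F, \sum_(k <- F) ((1 + freq_sqnorm R k) ^+ n)^-1 <= K.
Proof.
move=> n0; exists (2 ^+ n + 4 ^+ n * 2) => F.
pose g k : R := ((1 + freq_sqnorm R k) ^+ n)^-1.
have w1 k : 1 <= 1 + freq_sqnorm R k by rewrite lerDl freq_sqnorm_ge0.
have g0 k : 0 <= g k by rewrite invr_ge0 exprn_ge0// (le_trans _ (w1 k)).
have g1 k : g k <= 1 by rewrite invf_le1 ?exprn_gt0 ?exprn_ege1// (lt_le_trans _ (w1 k)).
have [Q FQ] := box_cover F.
apply: le_trans (fset_sum_subset FQ g0) _.
(* The subtracted term makes the induction close: the increment 2^(-Q) is exactly the growth of 2 -
   2 * 2^(-Q). *)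
suff : \sum_(k <- box (2 ^ Q)) g k <= 2 ^+ n + 4 ^+ n * (2 - 2 * 2^-1 ^+ Q).
  move=> h; apply: le_trans h _; rewrite lerD2l ler_pM2l ?exprn_gt0//.
  by rewrite gerBl mulr_ge0// exprn_ge0.
elim: Q {FQ} => [|Q IH].
  rewrite expr0 mulr1 subrr mulr0 addr0.
  apply: le_trans (_ : \sum_(k <- box (2 ^ 0)) 1 <= _); first by apply: ler_sum.
  by rewrite fset_sum_const mulr1 -[2 ^+ n]expr1 card_boxR.
rewrite (fset_sum_split _ (box (2 ^ Q))).
have h1 : \sum_(k <- (box (2 ^ Q.+1) `&` box (2 ^ Q))%fset) g k <= \sum_(k <- box (2 ^ Q)) g k.
  by apply: fset_sum_subset => //; exact: fsubsetIr.
have h2 : \sum_(k <- (box (2 ^ Q.+1) `\` box (2 ^ Q))%fset) g k <= 4 ^+ n * 2^-1 ^+ Q.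
  have gq k : k \in (box (2 ^ Q.+1) `\` box (2 ^ Q))%fset -> g k <= ((4 ^+ Q) ^+ n)^-1.
    rewrite inE => /andP[/freq_sqnorm_out_box kQ _].
    have kQ' : 4 ^+ Q <= 1 + freq_sqnorm R k.
      apply: (@le_trans _ _ (freq_sqnorm R k)); last by rewrite lerDr.
      apply: le_trans kQ; rewrite natrX -exprM mulnC exprM.
      by have -> : 2 ^+ 2 = 4 :> R by ring.
    rewrite lef_pV2 ?posrE ?exprn_gt0// ?(lt_le_trans _ (w1 k))//.
    by apply: lerXn2r; rewrite ?nnegrE ?exprn_ge0// (le_trans _ (w1 k)).
  apply: le_trans (_ : \sum_(k <- (box (2 ^ Q.+1) `\` box (2 ^ Q))%fset)
    ((4 ^+ Q) ^+ n)^-1 <= _).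
    by rewrite !big_seq; apply: ler_sum.
  rewrite fset_sum_const.
  have c1 : #|` (box (2 ^ Q.+1) `\` box (2 ^ Q))%fset|%:R <= (2 ^+ n) ^+ Q.+2 :> R.
    by apply: le_trans (card_boxR Q.+1); rewrite ler_nat fsubset_leq_card// fsubsetDl.
  apply: le_trans (ler_wpM2r _ c1) _; first by rewrite invr_ge0 !exprn_ge0.
  have -> : (2 ^+ n) ^+ Q.+2 / (4 ^+ Q) ^+ n = 4 ^+ n * (2^-1 ^+ Q) ^+ n :> R.
    have e4 : 4 = 2 ^+ 2 :> R by ring.
    have -> : (2 ^+ n) ^+ Q.+2 = 4 ^+ n * (2 ^+ Q) ^+ n :> R.
      by rewrite e4 -!exprM -exprD; congr (_ ^+ _); nia.
    have -> : (4 ^+ Q) ^+ n = (2 ^+ Q) ^+ n * (2 ^+ Q) ^+ n :> R.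
      by rewrite e4 -!exprM -exprD; congr (_ ^+ _); nia.
    rewrite !exprVn invfM !mulrA mulfK//.
  rewrite ler_pM2l ?exprn_gt0// -[leRHS]expr1; apply: ler_wiXn2l => //.
  by apply: exprn_ile1; lra.
apply: le_trans (lerD (le_trans h1 IH) h2) _.
by rewrite exprS [2 * (2^-1 * _)]mulrA divff ?mul1r ?pnatr_eq0//; lra.
Qed.

End boxes.

(** * Smooth elements *)

Section smooth_elements.
Variables (R : realType) (n : nat) (theta : 'M[R]_n) (s : R).
Hypothesis skew : theta^T = - theta.
Hypothesis n0 : (0 < n)%N.
Hypotheses (s0 : 0 < s) (sn : s <= n%:R).
Local Notation C := R[i].
Local Notation H := (L2 R n).
Local Notation N := (@L2norm R n).
Local Notation one := (L2one R n).
Local Notation e_ := (freq_vec theta).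
Variables (x : H -> H) (u : 'rV[int]_n -> C).
Hypothesis sx : selfadjoint x.
Hypothesis hu : rapidly_decaying u.
Hypothesis hF : is_Fourier_sum theta u x.
Implicit Types (k : 'rV[int]_n) (F B : {fset 'rV[int]_n}) (f : H).

Let lx : linear x := selfadjoint_linear sx.

Definition fourier_sum F f : H := \sum_(k <- F) u k *: Upow theta k f.

Lemma fourier_sum_linear F : linear (fourier_sum F).
Proof.
move=> a f g; rewrite /fourier_sum scaler_sumr -big_split /=; apply: eq_bigr => k _.
by rewrite Upow_linear scalerDr !scalerA mulrC.
Qed.

Lemma fourier_sum_approx (e : R) : 0 < e -> exists F0, forall F, (F0 `<=` F)%fset ->
  forall f, N (x f - fourier_sum F f) <= e * N f.
Proof.
move=> e0; have [F0 hF0] := hF e0; exists F0 => F /hF0 h.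
apply: (opnorm_lip _ h) => a f g /=.
rewrite lx -/(fourier_sum F _) (fourier_sum_linear F) scalerBr opprD.
by rewrite -!/(fourier_sum F _) addrACA.
Qed.

Lemma smooth_lip : exists2 M : R, 0 < M & lip x M.
Proof.
have [F0 /(_ _ (fsubset_refl F0)) h] := fourier_sum_approx ltr01.
pose K := \sum_(k <- F0) modc (u k).
have K0 : 0 <= K by apply: sumr_ge0 => k _; exact: modc_ge0.
exists (1 + K); first by rewrite ltr_pwDl.
move=> f; have h1 := h f.
have h2 : N (fourier_sum F0 f) <= K * N f.
  apply: le_trans (N_sum _ _ _) _; rewrite mulr_suml; apply: ler_sum => k _.
  by rewrite N_scale N_Upow.
have := N_sub (x f) (fourier_sum F0 f).
by rewrite mulrDl; lra.
Qed.

Lemma N_small_eq0 f (K : R) : (forall e : R, 0 < e -> N f <= e * K) -> f = 0.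
Proof.
move=> h; apply: N0_eq0; apply/eqP; rewrite eq_le N_ge0 andbT leNgt; apply/negP => f0.
have K0 : 0 < K.
  by have := h 1 ltr01; rewrite mul1r; exact: lt_le_trans.
have e0 : 0 < N f / (2 * K) by rewrite divr_gt0// mulr_gt0.
have := h _ e0; rewrite invfM mulrA divfK ?gt_eqF//; lra.
Qed.

(** The commutation holds for partial Fourier sums and passes to their norm limit. The phase is
    arbitrary because [fourier_coef] applies it to a conjugate phase. *)
Lemma smooth_commute c k f : unimodular c ->
  weyl c k (fun j => - weyl_vec theta k j) (x f) =
  x (weyl c k (fun j => - weyl_vec theta k j) f).
Proof.
move=> c1; set W := weyl c k _.
have lW : linear W by exact: weyl_linear.
apply/eqP; rewrite -subr_eq0; apply/eqP; apply: (@N_small_eq0 _ (2 * N f)) => e e0.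
have [F0 /(_ _ (fsubset_refl F0)) h] := fourier_sum_approx e0.
have WS g : W (fourier_sum F0 g) = fourier_sum F0 (W g).
  rewrite /fourier_sum (lin_sum lW); apply: eq_bigr => l _.
  by rewrite (linZ lW) UpowE /W (weyl_commute skew).
have -> : W (x f) - x (W f) = W (x f - fourier_sum F0 f) - (x (W f) - fourier_sum F0 (W f)).
  by rewrite (linB lW) WS opprB addrA subrK.
apply: le_trans (N_add _ _) _; rewrite NN.
have h1 := h (W f); have h2 := h f.
have eN g : N (W g) = N g by exact: N_weyl.
by rewrite eN in h1; rewrite eN; lra.
Qed.

Lemma N_one : N one = 1.
Proof. by rewrite /L2norm inner_one sqrtr1. Qed.

Lemma fourier_sum_one F : fourier_sum F one = \sum_(k <- F) u k *: e_ k.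
Proof. by []. Qed.

Lemma sqmod_eq0 (z : C) : sqmod z = 0 -> z = 0.
Proof.
case: z => a b; rewrite /sqmod /= => /eqP; rewrite paddr_eq0 ?sqr_ge0//.
by rewrite !sqrf_eq0 => /andP[/eqP -> /eqP ->].
Qed.

Lemma N_freq k : N (e_ k) = 1.
Proof. by rewrite /freq_vec N_Upow N_one. Qed.

Lemma inner_freq k : inner (x one) (e_ k) = u k.
Proof.
apply/eqP; rewrite -subr_eq0; apply/eqP; set z := _ - _.
have zE : z *: one = 0.
  apply: (@N_small_eq0 _ 1) => e e0.
  have [F0 /(_ (F0 `|` [fset k])%fset (fsubsetUl _ _) one)] := fourier_sum_approx e0.
  set F := (F0 `|` _)%fset; rewrite fourier_sum_one N_one; set d := x one - _ => h.
  have dz : inner d (e_ k) = z.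
    by rewrite innerBl inner_freq_sum !inE eqxx orbT.
  have E : re d (z *: e_ k) = sqmod z.
    rewrite /re innerZr dz; case: (z) => a b; rewrite /sqmod /=; ring.
  rewrite N_scale N_one mulr1.
  have [->|z0] := eqVneq (modc z) 0; first by rewrite mulr1 ltW.
  have zp : 0 < modc z by rewrite lt_def z0 modc_ge0.
  have := cauchy_schwarz d (z *: e_ k).
  rewrite E -modc_sqr N_scale N_freq mulr1 expr2 ler_pM2r// => h2.
  exact: le_trans h2 h.
have := congr1 N zE; rewrite N_scale N_one N0 mulr1 => /eqP.
rewrite -sqrf_eq0 modc_sqr => /eqP; exact: sqmod_eq0.
Qed.

(** At [1], [weyl_one_shift] turns the adjoint of U^k into a commutant operator, which passes
    through [x] and then to the other side of the inner product. This does the work of the trace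
    property of [tau]. *)
Lemma fourier_coef k : fourier theta x k = u k.
Proof.
have c1 := Upow_phase_unimodular theta k.
rewrite -inner_freq /fourier /tau /= UpowE (adjoint_weyl _ _ c1).
rewrite (dot_weyl_vec_diag skew) expi0 mulr1.
set c := Upow_phase theta k in c1 *.
rewrite weyl_one_shift -(weyl_one_shift _ _ (fun j => - weyl_vec theta (- k) j)).
rewrite -smooth_commute; last exact: unimodularJ.
rewrite -(weyl_isometry k (fun j => - weyl_vec theta k j) c1) weyl_comp subrr.
rewrite dotNr dotNl opprK (dot_weyl_vec_diag skew) expi0 mulr1 c1.
rewrite [X in weyl _ 0 X](_ : _ = fun=> 0); last first.
  by apply/funext => j; rewrite weyl_vecN opprK addNr.
by rewrite weyl1 -commutant_one.
Qed.

Definition weight k : R := (1 + freq_sqnorm R k) `^ s * sqmod (u k).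

Lemma freq_weight_ge1 k : 1 <= 1 + freq_sqnorm R k.
Proof. by rewrite lerDl freq_sqnorm_ge0. Qed.

Lemma sqmod_ge0 (z : C) : 0 <= sqmod z.
Proof. by rewrite addr_ge0 ?sqr_ge0. Qed.

Lemma weight_ge0 k : 0 <= weight k.
Proof. by rewrite mulr_ge0 ?powR_ge0 ?sqmod_ge0. Qed.

Lemma Re_norm (z : C) : complex.Re `|z| = modc z.
Proof. by rewrite normc_def. Qed.

(** Rapid decay of order n gives w^n |u_k|^2 <= M^2 w^(-n), where w = 1 + |k|^2 >= 1 and so w^s <=
    w^n. *)
Lemma weight_bound : exists K : R, forall F, \sum_(k <- F) weight k <= K.
Proof.
have [K hK] := weight_summable R n0.
have [M hM] := hu n.
exists (M ^+ 2 * K) => F.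
apply: le_trans (_ : \sum_(k <- F) M ^+ 2 * ((1 + freq_sqnorm R k) ^+ n)^-1 <= _); last first.
  by rewrite -mulr_sumr ler_wpM2l ?sqr_ge0.
apply: ler_sum => k _; have w1 := freq_weight_ge1 k.
set w := 1 + _ in w1 *.
have w0 : 0 < w by exact: lt_le_trans w1.
have h1 : weight k <= w ^+ n * sqmod (u k).
  rewrite /weight ler_wpM2r ?sqmod_ge0// -powR_mulrn ?(ltW w0)//.
  exact: ler_powR.
apply: le_trans h1 _; rewrite ler_pdivlMr ?exprn_gt0//.
have := hM k; rewrite -/w Re_norm => hk.
rewrite -modc_sqr mulrAC -expr2 -exprMn ler_sqr ?nnegrE//.
  by rewrite mulr_ge0 ?exprn_ge0 ?modc_ge0// ltW.
by apply: le_trans hk; rewrite mulr_ge0 ?exprn_ge0 ?modc_ge0// ltW.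
Qed.

Lemma sobolev_sqr F : \sum_(k <- F) weight k <= sobolev_norm theta s x ^+ 2.
Proof.
rewrite /sobolev_norm.
have -> : \esum_(k in setT) ((1 + freq_sqnorm R k) `^ s *
   complex.Re `|fourier theta x k| ^+ 2)%:E = \esum_(k in setT) (weight k)%:E.
  by apply: eq_esum => k _; rewrite fourier_coef Re_norm modc_sqr.
set E := esum _ _.
have E0 : (0 <= E)%E by apply: esum_ge0 => k _; rewrite lee_fin weight_ge0.
(* As [fine] sends +oo to 0, finiteness must be known before the Sobolev norm can bound anything. *)
have Efin : E \is a fin_num.
  rewrite ge0_fin_numE//; have [K hK] := weight_bound.
  apply: (@le_lt_trans _ _ K%:E); last exact: ltry.
  apply: ub_ereal_sup => _ [A [finA _] <-].
  by rewrite fsbig_finite//= sumEFin lee_fin.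
rewrite sqr_sqrtr ?fine_ge0//.
rewrite -lee_fin fineK//; apply: esum_ge; exists [set` F]; first by split.
by rewrite -fsbig_seq//= sumEFin.
Qed.

(** Finite Parseval sums over F minus [B] obey the bound, and x 1 is a limit of such partial sums.
    The two uses are the empty set with r = 1 and a box with r = 4^(-s Q). *)
Lemma tail_bound B (r : R) : 0 <= r ->
  (forall k, k \notin B -> 1 <= r * (1 + freq_sqnorm R k) `^ s) ->
  N (x one - \sum_(k <- B) u k *: e_ k) ^+ 2 <= r * sobolev_norm theta s x ^+ 2.
Proof.
move=> r0 hB; set z := x one - _; set D := r * _.
have D0 : 0 <= D by rewrite mulr_ge0 ?sqr_ge0.
suff h : N z <= Num.sqrt D.
  by rewrite -(sqr_sqrtr D0) ler_sqr ?nnegrE ?N_ge0 ?sqrtr_ge0.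
rewrite leNgt; apply/negP => hlt.
have e0 : 0 < (N z - Num.sqrt D) / 2 by rewrite divr_gt0 ?subr_gt0.
have [F0 /(_ (F0 `|` B)%fset (fsubsetUl _ _) one)] := fourier_sum_approx e0.
set F := (F0 `|` B)%fset; rewrite fourier_sum_one N_one mulr1 => h1.
have FB : (F `&` B)%fset = B by apply/fsetIidPr; exact: fsubsetUr.
have sF := fset_sum_split F B (fun k => u k *: e_ k); rewrite FB in sF.
set t := \sum_(k <- (F `\` B)%fset) _ in sF.
have zE : z = (x one - \sum_(k <- F) u k *: e_ k) + t.
  by rewrite sF /z opprD addrA subrK.
have ht : N t <= Num.sqrt D.
  rewrite -ler_sqr ?nnegrE ?N_ge0 ?sqrtr_ge0// [leRHS]sqr_sqrtr// /t N_freq_sum.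
  apply: (@le_trans _ _ (\sum_(k <- (F `\` B)%fset) r * weight k)).
    rewrite big_seq [leRHS]big_seq; apply: ler_sum => k.
    rewrite inE => /andP[kB _]; rewrite /weight mulrA.
    by rewrite ler_peMl ?sqmod_ge0//; exact: hB.
  by rewrite -mulr_sumr ler_wpM2l//; exact: sobolev_sqr.
have := N_add (x one - \sum_(k <- F) u k *: e_ k) t; rewrite -zE.
by move: h1 ht hlt; lra.
Qed.

Lemma N_xi_le : N (x one) ^+ 2 <= sobolev_norm theta s x ^+ 2.
Proof.
have := @tail_bound fset0 1 ler01; rewrite big_seq_fset0 subr0 mul1r; apply.
move=> k _; rewrite mul1r; apply: (@le_trans _ _ (1 `^ s)); first by rewrite powR1.
apply: ge0_ler_powR; rewrite ?nnegrE ?(ltW s0) ?freq_weight_ge1//.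
by rewrite addr_ge0 ?freq_sqnorm_ge0.
Qed.

Definition low_freq Q f : H :=
  \sum_(k <- box n (2 ^ Q)) u k *: commutant_weyl theta k f.

Lemma low_freq_linear Q : linear (low_freq Q).
Proof.
move=> a f g; rewrite /low_freq scaler_sumr -big_split /=; apply: eq_bigr => k _.
have lW : linear (commutant_weyl theta k) by exact: weyl_linear.
by rewrite lW scalerDr !scalerA mulrC.
Qed.

Lemma modc_coef_le k : modc (u k) <= N (x one).
Proof.
have [->|z0] := eqVneq (modc (u k)) 0; first exact: N_ge0.
have zp : 0 < modc (u k) by rewrite lt_def z0 modc_ge0.
have E : re (x one) (u k *: e_ k) = sqmod (u k).
  rewrite /re innerZr inner_freq; case: (u k) => a b; rewrite /sqmod /=; ring.
have := cauchy_schwarz (x one) (u k *: e_ k).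
by rewrite E -modc_sqr N_scale N_freq mulr1 expr2 ler_pM2r.
Qed.

(** Number of frequencies times largest coefficient: this is the level L^(Q+1) c of
    [entropy_poly_bound] for L = 2^n. *)
Lemma lip_low_freq Q : lip (low_freq Q) ((2 ^+ n) ^+ Q.+1 * N (x one)).
Proof.
move=> f; apply: le_trans (N_sum _ _ _) _.
apply: (@le_trans _ _ (\sum_(k <- box n (2 ^ Q)) N (x one) * N f)).
  by apply: ler_sum => k _; rewrite N_scale N_commutant ler_wpM2r ?N_ge0 ?modc_coef_le.
rewrite fset_sum_const mulrA; do 2 (apply: ler_wpM2r; first exact: N_ge0).
exact: card_boxR.
Qed.

Lemma low_freq_commute Q f : low_freq Q (x f) = x (low_freq Q f).
Proof.
rewrite /low_freq (lin_sum lx); apply: eq_bigr => k _.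
by rewrite (linZ lx) /commutant_weyl smooth_commute//; exact: Upow_phase_unimodular.
Qed.

Lemma low_freq_tail Q : N (x one - low_freq Q one) ^+ 2 <=
  (4 `^ (- s)) ^+ Q * sobolev_norm theta s x ^+ 2.
Proof.
have -> : low_freq Q one = \sum_(k <- box n (2 ^ Q)) u k *: e_ k.
  by apply: eq_bigr => k _; rewrite commutant_one.
apply: tail_bound => [|k kB]; first by rewrite exprn_ge0 ?powR_ge0.
have h : 4 ^+ Q <= 1 + freq_sqnorm R k.
  apply: (@le_trans _ _ (freq_sqnorm R k)); last by rewrite lerDr.
  apply: le_trans (freq_sqnorm_out_box R kB).
  rewrite natrX -exprM mulnC exprM.
  by have -> : 2 ^+ 2 = 4 :> R by ring.
rewrite -powR_mulrn ?powR_ge0// -powRrM mulNr powRN mulrC ler_pdivlMr ?powR_gt0//.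
rewrite mul1r [s * _]mulrC powRrM powR_mulrn// ge0_ler_powR ?nnegrE ?(ltW s0)//.
by rewrite addr_ge0 ?freq_sqnorm_ge0.
Qed.

End smooth_elements.

(** * The entropy bound *)

Section entropy.
Variables (R : realType) (n : nat).
Local Notation C := R[i].
Local Notation H := (L2 R n).
Local Notation N := (@L2norm R n).
Local Notation one := (L2one R n).
Implicit Types (x T S : H -> H).

Lemma poly_op_comp (p q : {poly R}) T f : linear T ->
  poly_op (p \Po q) T f = poly_op p (poly_op q T) f.
Proof.
move=> lT; have lq := poly_op_linear q lT.
elim/poly_ind: p f => [|p c IH] f; first by rewrite comp_poly0 -!polyC0 !poly_opC.
rewrite comp_poly_MXaddC !poly_opD !poly_opC poly_opM// poly_opM//.
by rewrite poly_opX IH.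
Qed.

Lemma poly_op_sqr T f : linear T -> poly_op ('X^2) T f = T (T f).
Proof. by move=> lT; rewrite expr2 poly_opM// !poly_opX. Qed.

Lemma lin_scaled_sqr (a : C) x : linear x -> linear (a \*: (x \o x))%R.
Proof.
move=> lx b f g; rewrite -[LHS]/(a *: x (x _)) !lx scalerDr !scalerA mulrC.
by rewrite -scalerA.
Qed.

(** Since x^2 - t^2 = (x + t)(x - t), the same vectors serve. This links the approximate eigenvalues
    of [x], where positivity is tested, to the spectrum of c^(-2) x^2, where polynomials approximate
    the logarithm. *)
Lemma approx_eig_sqr x (M t a : R) : linear x -> lip x M -> 0 < M -> 0 <= t -> 0 < a ->
  approx_eig x t%:C -> approx_eig (a%:C \*: (x \o x))%R (a * t ^+ 2)%:C.
Proof.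
move=> lx hM M0 t0 a0 ht e e0.
have K0 : 0 < a * (M + t) by rewrite mulr_gt0// ltr_pwDl.
have [|f f1 hf] := ht (e / (a * (M + t))); first by rewrite divr_gt0.
exists f => //.
have -> : (a%:C \*: (x \o x))%R f - (a * t ^+ 2)%:C *: f =
    a%:C *: (x (x f - t%:C *: f) + t%:C *: (x f - t%:C *: f)).
  rewrite (linB lx) (linZ lx) scalerBr addrA subrK scalerBr -[LHS]/(a%:C *: x (x f) - _).
  by congr (_ - _); rewrite !scalerA -!rmorphM expr2 mulrA.
rewrite N_scaleR ?(ltW a0)//; set d := x f - _ in hf *.
have h1 := N_add (x d) (t%:C *: d); rewrite N_scaleR// in h1.
have h2 := hM d.
have h3 : a * N (x d + t%:C *: d) <= a * (M + t) * N d.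
  by rewrite -mulrA ler_pM2l// mulrDl; lra.
by apply: le_lt_trans h3 _; rewrite mulrC -ltr_pdivlMr.
Qed.

(** The first term is the pointwise loss in [entropy_poly_bound]; the second pays for its cutoffs,
    the j-th one costing 4^(-s j). *)
Definition entropy_const (L s : R) : R :=
  50 * ln L + 4 * ln L * (1 - 4 `^ (- s))^-1.

Lemma sum_geom_le (q : R) J : 0 <= q -> q < 1 -> \sum_(0 <= j < J) q ^+ j <= (1 - q)^-1.
Proof.
move=> q0 q1; have d0 : 0 < 1 - q by rewrite subr_gt0.
rewrite -[leRHS]mul1r ler_pdivlMr// mulrC big_mkord.
have := subrXX 1 q J; rewrite expr1n.
under eq_bigr do rewrite expr1n mul1r.
by move=> <-; rewrite gerBl exprn_ge0.
Qed.

Lemma pow4N_lt1 (s : R) : 0 < s -> 4 `^ (- s) < 1 :> R.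
Proof.
move=> s0; rewrite powRN invf_lt1 ?powR_gt0//.
by rewrite /powR gt_eqF// expR_gt1 mulr_gt0// ln_gt0// ltr1n.
Qed.

Variables (theta : 'M[R]_n) (s : R) (x : H -> H) (u : 'rV[int]_n -> C).
Hypotheses (skew : theta^T = - theta) (n0 : (0 < n)%N) (s0 : 0 < s) (sn : s <= n%:R).
Hypotheses (px : strictly_positive x) (hu : rapidly_decaying u).
Hypothesis hF : is_Fourier_sum theta u x.
Local Notation c := (N (x one)).
Local Notation T := ((c ^- 2)%:C \*: (x \o x))%R.

Lemma poly_entropy_bound (p : {poly R}) (e : R) : 0 < c ->
  (forall l : R, spectrum T l%:C -> `|p.[l] - ln l| <= e) ->
  re (poly_op p T one) (x (x one)) <=
  e * c ^+ 2 + entropy_const (2 ^+ n) s * sobolev_norm theta s x ^+ 2.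
Proof.
move=> c0 hp.
have [sx spx] := px.
have lx := selfadjoint_linear sx.
have sxr := selfadjoint_re sx.
have [M M0 hM] := smooth_lip sx hF.
have L2 : 2 <= 2 ^+ n :> R by rewrite -{1}[2]expr1 ler_weXn2l// ler1n.
have lnL : 0 <= ln (2 ^+ n) :> R by rewrite ln_ge0// (le_trans _ L2)// ler1n.
set L := 2 ^+ n in L2 lnL *.
have c2 : 0 < c ^+ 2 by rewrite exprn_gt0.
have [J [b hb]] := entropy_poly_bound L2 M0 c0.
have eigP l : approx_eig x l -> exists2 t : R, l = t%:C &
    [/\ 0 < t, t <= M & spectrum T (t ^+ 2 / c ^+ 2)%:C].
  move=> al; have := spx _ (approx_eig_spectrum lx al).
  case: l al => t t' al; rewrite ltcE /= => /andP[/eqP t'0 t0].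
  rewrite t'0 in al *; exists t => //; split => //; first exact: approx_eig_le hM al.
  apply: approx_eig_spectrum; first exact: lin_scaled_sqr.
  rewrite mulrC; apply: (approx_eig_sqr lx hM) => //; first exact: ltW.
  by rewrite invr_gt0.
pose q : {poly R} := (c ^- 2) *: 'X^2.
pose B : {poly R} := \sum_(0 <= j < J) ('X - (2 * (L ^+ j.+1 * c))%:P) * b j.
(* D >= 0 at the approximate eigenvalues of [x] is the scalar entropy inequality with [p], up to the
   error [e], in place of the logarithm. Positivity of the form of D(x) at [1] then gives the
   claim. *)
pose D : {poly R} := (e + 50 * ln L) *: 'X^2 + (4 * ln L) *: B - 'X^2 * (p \Po q).
have := @poly_op_ge0 _ _ x M D sx (ltW M0) hM _ one.
have Dpos l : approx_eig x l -> exists2 r : R, l = r%:C & 0 <= D.[r].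
  move=> /eigP[t -> [t0 tM spt]]; exists t => //.
  have [_ hent] := hb _ t0 tM.
  have hl := hp _ spt; rewrite ler_distl in hl; move: hl => /andP[_ hl].
  have -> : D.[t] = (e + 50 * ln L) * t ^+ 2 +
      4 * ln L * (\sum_(0 <= j < J) (t - 2 * (L ^+ j.+1 * c)) * (b j).[t]) -
      t ^+ 2 * p.[t ^+ 2 / c ^+ 2].
    rewrite /D hornerD hornerN hornerD !hornerZ (hornerM 'X^2).
    rewrite horner_comp /q hornerZ !hornerXn.
    rewrite /B horner_sum [_ * t ^+ 2]mulrC -[c ^- 2 * _]mulrC.
    under eq_bigr do rewrite hornerM hornerXsubC.
    by rewrite [X in X + _ - _]mulrC.
  have t2 : 0 < t ^+ 2 by rewrite exprn_gt0.
  have h2 : t ^+ 2 * p.[t ^+ 2 / c ^+ 2] <= t ^+ 2 * (ln (t ^+ 2 / c ^+ 2) + e).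
    by rewrite ler_pM2l.
  by move: hent h2; lra.
move=> /(_ Dpos).
have xx : re (x (x one)) one = c ^+ 2 by rewrite sxr N_sqr.
have pq : poly_op (p \Po q) x one = poly_op p T one.
  rewrite poly_op_comp//; congr (poly_op p _ one); apply/funext => f.
  by rewrite /q poly_opZ poly_op_sqr.
have Bbound : re (poly_op B x one) one <= (1 - 4 `^ (- s))^-1 * sobolev_norm theta s x ^+ 2.
  rewrite /B poly_op_sum re_sum_l.
  apply: (@le_trans _ _ (\sum_(0 <= j < J) (4 `^ (- s)) ^+ j * sobolev_norm theta s x ^+ 2)).
    apply: ler_sum => j _.
    apply: le_trans (low_freq_tail skew n0 s0 sn sx hu hF j).
    apply: (truncation_bound (M := M)) => //.
    - exact: low_freq_linear.
    - by rewrite mulr_ge0 ?N_ge0// exprn_ge0// (le_trans _ L2).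
    - exact: lip_low_freq.
    - exact: low_freq_commute.
    - move=> l /eigP[t -> [t0 tM _]]; exists t => //.
      by have [h _] := hb _ t0 tM.
  rewrite -mulr_suml ler_wpM2r ?sqr_ge0//.
  by apply: sum_geom_le; [exact: powR_ge0|exact: pow4N_lt1].
have cs := N_xi_le skew n0 s0 sn sx hu hF.
rewrite /D poly_opB poly_opD !poly_opZ poly_opM// !poly_op_sqr// pq.
rewrite reBl reDl !reZl xx [re (x (x (poly_op p _ _))) _]sxr [re (x (poly_op p _ _)) _]sxr.
set P := re _ (x (x one)); set S2 := sobolev_norm theta s x ^+ 2 in Bbound cs *.
set G := (1 - _)^-1 in Bbound *; rewrite /entropy_const -/G.
have h1 : 50 * ln L * c ^+ 2 <= 50 * ln L * S2 by rewrite ler_wpM2l// mulr_ge0.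
have h2 : 4 * ln L * re (poly_op B x one) one <= 4 * ln L * (G * S2).
  by rewrite ler_wpM2l// mulr_ge0.
by move: h1 h2; lra.
Qed.

Lemma tau_normE : tau_norm x = c.
Proof.
have [sx _] := px; have lx := selfadjoint_linear sx.
have [M M0 hM] := smooth_lip sx hF.
rewrite /tau_norm (adjoint_eq (bounded_op_of_lip (ltW M0) lx hM) sx).
by rewrite -[tau _]/(inner (x (x one)) one) sx.
Qed.

Lemma tau_entropy_bound S :
  0 < c -> is_functional_calculus (@ln R) T S ->
  tau ((x \o x) \o S) <=
    (entropy_const (2 ^+ n) s * sobolev_norm theta s x ^+ 2)%:C.
Proof.
move=> c0 [bS [p hp hc]].
have [sx _] := px; have lx := selfadjoint_linear sx.
have lT : linear T by exact: lin_scaled_sqr.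
pose eta := x (x one).
have -> : tau ((x \o x) \o S) = inner (S one) eta by rewrite /tau /= !sx.
have [lS _] := bounded_op_lip bS.
have approx (e : R) : 0 < e -> exists2 q : {poly R},
    (forall l : R, spectrum T l%:C -> `|q.[l] - ln l| <= e) &
    N (poly_op q T one - S one) <= e.
  move=> e0.
  have h1 : \forall m \near \oo, (opnorm (poly_op (p m) T \- S)%R < e%:E)%E.
    have e0' : (0 < e%:E)%E by rewrite lte_fin.
    exact: (hc _ (open_ereal_lt' e0')).
  have [m [hm1 hm2]] : exists m, (forall l : R, spectrum T l%:C -> `|(p m).[l] - ln l| <= e)
      /\ (opnorm (poly_op (p m) T \- S)%R < e%:E)%E.
    have : \forall m \near \oo, (forall l : R, spectrum T l%:C -> `|(p m).[l] - ln l| <= e)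
      /\ (opnorm (poly_op (p m) T \- S)%R < e%:E)%E.
      by near=> m; split; near: m; [exact: hp|exact: h1].
    by move=> [m _ hm]; exists m; exact: (hm m (leqnn m)).
  exists (p m) => //.
  have := @opnorm_lip _ _ (poly_op (p m) T \- S)%R e _ hm2 one.
  rewrite N_one mulr1; apply=> a f g /=.
  by rewrite (poly_op_linear _ lT) lS scalerBr opprD addrACA.
(* The order of [R[i]] demands equal imaginary parts, so the trace must be shown real. It is real
   for every polynomial in [T], which commutes with [x], and [S] is a limit of these. *)
rewrite lecE; apply/andP; split.
- apply/eqP; rewrite -[LHS]/(0 : R); apply/esym.
  (* Pairing with i eta turns the imaginary part into a real part, so that Cauchy-Schwarz
     applies. *)
  have Imre z : complex.Im (inner z eta) = re z ('i%C *: eta).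
    by rewrite /re innerZr; case: (inner z eta) => a b /=; ring.
  have small (e : R) : 0 < e -> `|complex.Im (inner (S one) eta)| <= e * N ('i%C *: eta).
    move=> e0; have [q _ hq] := approx _ e0.
    have Im0 : complex.Im (inner (poly_op q T one) eta) = 0.
      have sT : selfadjoint T.
        move=> f g; rewrite -[LHS]/(inner (_ *: x (x f)) g) -[RHS]/(inner f (_ *: x (x g))).
        by rewrite innerZl innerZr conjc_real !sx.
      have -> : inner (poly_op q T one) eta = inner (x (x (poly_op q T one))) one.
        by rewrite !sx.
      have xT f : x (T f) = T (x f) by rewrite -[LHS]/(x (_ *: x (x f))) (linZ lx).
      have xxq : x (x (poly_op q T one)) = poly_op q T eta.
        by rewrite !(poly_op_comm _ _ lx xT).
      have e1 : inner (x (x (poly_op q T one))) one = inner eta (poly_op q T one).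
        by rewrite xxq (poly_op_selfadjoint q sT).
      have e2 : inner (x (x (poly_op q T one))) one = inner (poly_op q T one) eta.
        by rewrite !sx.
      have : inner eta (poly_op q T one) = (inner eta (poly_op q T one))^*%C.
        by rewrite -innerC -e2 e1.
      rewrite e1; case: (inner eta _) => a b /= [] hab; lra.
    have -> : complex.Im (inner (S one) eta) = - re (poly_op q T one - S one) ('i%C *: eta).
      by rewrite reBl -!Imre Im0 sub0r opprK.
    rewrite normrN; apply: le_trans (cauchy_schwarz_norm _ _) _.
    by rewrite ler_wpM2r ?N_ge0.
  apply/eqP; rewrite -normr_eq0 eq_le normr_ge0 andbT leNgt; apply/negP => i0.
  have K0 : 0 < N ('i%C *: eta) + 1 by rewrite ltr_wpDl ?N_ge0.
  have e0 : 0 < `|complex.Im (inner (S one) eta)| / (2 * (N ('i%C *: eta) + 1)).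
    by rewrite divr_gt0// mulr_gt0.
  have := small _ e0; rewrite leNgt => /negP; apply.
  rewrite mulrAC ltr_pdivrMr ?mulr_gt0// ltr_pM2l//.
  by have := N_ge0 ('i%C *: eta); lra.
- rewrite -[leLHS]/(re (S one) eta)
    -[leRHS]/(entropy_const (2 ^+ n) s * sobolev_norm theta s x ^+ 2).
  apply/ler_addgt0Pr => e e0.
  (* Two errors of size e/K occur, one weighted by c^2 (the logarithm on the spectrum), one by the
     norm of eta (the operator [S]); together they make e. *)
  pose K := c ^+ 2 + N eta.
  have K0 : 0 < K by rewrite ltr_pwDl ?N_ge0// exprn_gt0.
  have d0 : 0 < e / K by rewrite divr_gt0.
  have [q hq1 hq2] := approx _ d0.
  have h1 := poly_entropy_bound c0 hq1.
  have h2 := cauchy_schwarz_norm (poly_op q T one - S one) eta.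
  have h3 : N (poly_op q T one - S one) * N eta <= e / K * N eta by rewrite ler_wpM2r ?N_ge0.
  rewrite reBl ler_norml in h2; move: h2 => /andP[h2 _].
  have eK : e / K * c ^+ 2 + e / K * N eta = e by rewrite -mulrDr divfK ?gt_eqF.
  rewrite -/eta in h1.
  by move: h1 h2 h3 eK; lra.
Unshelve. all: by end_near. Qed.

End entropy.

Theorem theorem1p1 (R : realType) (n : nat) (a s : R) :
  (2 <= n)%N -> 0 < a -> 0 < s -> s < n%:R / 2 ->
  exists C : R, 0 < C /\
    forall (theta : 'M[R]_n) (x : L2 R n -> L2 R n),
      theta^T = - theta ->
      smooth theta x -> strictly_positive x ->
      tau ((x \o x) \o
           functional_calculus (@ln R) ((tau_norm x ^- 2)%:C \*: (x \o x)))
      <= (C * sobolev_norm theta s x ^+ 2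
          - n%:R / s * (ln a + 1) * tau_norm x ^+ 2)%:C.
Proof.
move=> n2 a0 s0 sn2.
have n0 : (0 < n)%N by exact: leq_trans n2.
have sn : s <= n%:R.
  by apply: le_trans (ltW sn2) _; rewrite ler_pdivrMr// ler_peMr// ler1n.
pose K := n%:R / s * (ln a + 1); pose L : R := 2 ^+ n.
have L1 : 1 < L by rewrite exprn_egt1 ?ltr1n// -lt0n.
have C0 : 0 < entropy_const L s.
  rewrite ltr_pwDl//; first by rewrite mulr_gt0// ln_gt0.
  by rewrite !mulr_ge0 ?ln_ge0 ?(ltW L1)// invr_ge0 subr_ge0 ltW// pow4N_lt1.
(* The dependence on [a] sits in |K|: as c is at most the Sobolev norm, |K| times its square
   dominates K c^2 for either sign of K. *)
exists (entropy_const L s + `|K|); split; first by rewrite ltr_pwDl.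
move=> theta x skew [_ [u hu hF]] px.
have [sx _] := px; have lx := selfadjoint_linear sx.
have cE := tau_normE px hF.
have cs := N_xi_le skew n0 s0 sn sx hu hF.
rewrite -/K cE; set c := L2norm (x (L2one R n)) in cs *.
set S2 := sobolev_norm theta s x ^+ 2 in cs *.
have c20 : 0 <= c ^+ 2 by rewrite sqr_ge0.
have rest : 0 <= `|K| * S2 - K * c ^+ 2.
  have h1 : K * c ^+ 2 <= `|K| * c ^+ 2 by rewrite ler_wpM2r// ler_norm.
  have h2 : `|K| * c ^+ 2 <= `|K| * S2 by rewrite ler_wpM2l.
  by lra.
have S20 : 0 <= S2 by exact: le_trans cs.
have CS : 0 <= entropy_const L s * S2 by rewrite mulr_ge0// ltW.
have rhs : (entropy_const L s * S2)%:C <=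
    ((entropy_const L s + `|K|) * S2 - K * c ^+ 2)%:C by rewrite lecR; lra.
apply: le_trans rhs.
(* If x 1 = 0, the trace vanishes whatever the functional calculus returns, being a pairing with x
   (x 1). *)
have [c0|c0] := eqVneq c 0.
  rewrite /tau /= !sx (N0_eq0 c0) (lin0 lx) innerC inner0l conjc0.
  by rewrite ler0c.
have cp : 0 < c by rewrite lt_def c0 N_ge0.
(* When [xget] falls back on its default, the operator is 0 and the trace is 0, below the
   nonnegative bound [CS]. *)
rewrite /functional_calculus; case: xgetP => [S _ hS|_].
  exact: (tau_entropy_bound skew n0 s0 sn px hu hF cp hS).
by rewrite /tau /= !(lin0 lx) inner0l ler0c.
Qed.
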